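(* Let $a,b,c\in\mathbb{R}$ be such that $a>-1$, $b>-1$ and $c>\max\{0,a-b\}$, and let $d\in\{0,1\}$. For admissible parameters, let $\{P_n^{[d]}(x;a,b,c)\}_{n\in\mathbb{N}}$ be the monic $2$-orthogonal polynomial sequence with respect to $\overline{\mathcal{W}}^{[d]}(x;a,b,c)$ and let $Q_n^{[d]}(x;a,b,c)$, $n\in\mathbb{N}$, be the type I function for the index of length $n$ on the step-line with respect to $\overline{\mathcal{W}}^{[d]}(x;a,b,c)$. Then, for all $n\in\mathbb{N}$, $$\frac{d}{dx}\left(P_{n+1}^{[d]}(x;a,b,c)\right)=(n+1)\,P_n^{[1-d]}(x;a+1,b+1,c+d)$$ and $$\frac{d}{dx}\left(Q_n^{[1-d]}(x;a+1,b+1,c+d)\right)=-n\,Q_{n+1}^{[d]}(x;a,b,c).$$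
   Context: $\mathbb{N}=\{0,1,2,\dots\}$. For $\alpha>0$, $\beta\in\mathbb{R}$, $x>0$, the Tricomi function is $\mathbf{U}(\alpha,\beta;x)=\frac{1}{\Gamma(\alpha)}\int_0^\infty t^{\alpha-1}(t+1)^{\beta-\alpha-1}e^{-tx}\,dt$. For $a>-1$, $b>-1$, $c>\max\{0,a-b\}$ (admissible parameters) and $x>0$ define $$\mathcal{W}(x;a,b,c)=\frac{\Gamma(c+b+1)}{\Gamma(a+1)\Gamma(b+1)}\,e^{-x}x^a\,\mathbf{U}(c,a-b+1;x),\qquad \overline{\mathcal{W}}^{[d]}(x;a,b,c)=\begin{bmatrix}\mathcal{W}(x;a,b,c+d)\\ \mathcal{W}(x;a,b,c+1-d)\end{bmatrix},\quad d\in\{0,1\}.$$ Let $(w_0,w_1)$ be a vector of weight functions on $(0,\infty)$. A polynomial sequence $\{P_n\}_{n\in\mathbb{N}}$ ($\deg P_n=n$) is $2$-orthogonal with respect to $(w_0,w_1)$ if for all $k,n\in\mathbb{N}$: $\int_0^\infty x^kP_n w_0\,dx=0$ if $n\ge 2k+1$ and $\neq0$ if $n=2k$; and $\int_0^\infty x^kP_n w_1\,dx=0$ if $n\ge 2k+2$ and $\neq 0$ if $n=2k+1$. The type I function for the index of length $n$ on the step-line with respect to $(w_0,w_1)$ is $Q_n=A_nw_0+B_nw_1$, where $A_n,B_n$ are polynomials with $\deg A_n\le\lceil n/2\rceil-1$, $\deg B_n\le\lfloor n/2\rfloor-1$ (a polynomial of degree $\le -1$ is zero; so $Q_0=0$)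 such that $\int_0^\infty x^kQ_n(x)\,dx=0$ for $0\le k\le n-2$ and $=1$ for $k=n-1$. For the weights considered here all these objects exist and are unique. *)

(* Defs.v *)
From HB Require Import structures.
From mathcomp Require Import all_boot all_order all_algebra.
From mathcomp Require Import all_classical all_reals all_analysis.

Set Implicit Arguments.
Unset Strict Implicit.
Unset Printing Implicit Defensive.

Import Order.TTheory GRing.Theory Num.Theory.
Import numFieldNormedType.Exports.

Local Open Scope classical_set_scope.
Local Open Scope ring_scope.

Section Weights.
Context {R : realType}.
Local Notation mu := (@lebesgue_measure R).

(* Used only for s > 0, where the integral converges. *)
Definition Gamma (s : R) : R :=
  \int[mu]_(t in `]0, +oo[) (t `^ (s - 1) * expR (- t)).

(* Used only for alpha > 0 and x > 0, where the integral converges. *)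
Definition Tricomi (alpha beta x : R) : R :=
  (Gamma alpha)^-1 *
  \int[mu]_(t in `]0, +oo[)
    (t `^ (alpha - 1) * (t + 1) `^ (beta - alpha - 1) * expR (- (t * x))).

Definition W (a b c x : R) : R :=
  Gamma (c + b + 1) / (Gamma (a + 1) * Gamma (b + 1)) *
  expR (- x) * x `^ a * Tricomi c (a - b + 1) x.

(* The two components of the vector of weights; meant for d = 0 or d = 1. *)
Definition Wbar (d : nat) (a b c : R) : (R -> R) * (R -> R) :=
  (W a b (c + d%:R), W a b (c + 1 - d%:R)).

(* Extended-real valued, so that an equation between [moment k f] and a real
   number entails the integrability of x ^+ k * f x on the half-line. *)
Definition moment (k : nat) (f : R -> R) : \bar R :=
  (\int[mu]_(x in `]0%R, +oo[) (x ^+ k * f x)%:E)%E.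

Definition two_orthogonal (w : (R -> R) * (R -> R)) (P : nat -> {poly R}) :=
  (forall n, size (P n) = n.+1) /\
  (forall k n : nat,
    [/\ (2 * k + 1 <= n)%N -> moment k (fun x => (P n).[x] * w.1 x) = 0%E,
        n = (2 * k)%N -> moment k (fun x => (P n).[x] * w.1 x) <> 0%E,
        (2 * k + 2 <= n)%N -> moment k (fun x => (P n).[x] * w.2 x) = 0%E
      & n = (2 * k + 1)%N -> moment k (fun x => (P n).[x] * w.2 x) <> 0%E]).

Definition monic_two_orthogonal (w : (R -> R) * (R -> R))
    (P : nat -> {poly R}) :=
  two_orthogonal w P /\ forall n, P n \is monic.

(* Since size = degree + 1, the bounds on sizes below are
   deg A <= ceil(n/2) - 1 and deg B <= floor(n/2) - 1.  Only the values of Q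
   on the half-line are constrained. *)
Definition typeI_function (w : (R -> R) * (R -> R)) (n : nat) (Q : R -> R) :=
  exists A B : {poly R},
    [/\ (size A <= uphalf n)%N,
        (size B <= n./2)%N,
        forall x, 0 < x -> Q x = A.[x] * w.1 x + B.[x] * w.2 x,
        forall k : nat, (k + 2 <= n)%N -> moment k Q = 0%E
      & forall k : nat, (k + 1)%N = n -> moment k Q = 1%E].

End Weights.

(* Main.v *)
Require Import Defs.
From HB Require Import structures.
From mathcomp Require Import all_boot all_order all_algebra.
From mathcomp Require Import all_classical all_reals all_analysis.
From mathcomp Require Import ring lra zify measurable_realfun.
Import Order.TTheory GRing.Theory Num.Theory.
Import numFieldNormedType.Exports.
Local Open Scope ring_scope.

(** Fix [a] and [b], write [A = a + 1], [B = b + 1], [C = c + b + 1], and let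
    [w_c] be the weight [W a b c].  Since
    [e^(-x) U(c, a - b + 1; x) = Gamma(c)^-1
       \int_0^oo t^(c-1) (t+1)^(a-b-c) e^(-(t+1)x) dt],
    everything about [w_c] comes from the integrals
    [Kint p q x = \int_0^oo t^p (t+1)^q e^(-tx) dt].  Differentiation under the
    integral sign ([Kint_is_derive]), integration by parts in [t]
    ([Kint_by_parts]) and splitting off a factor [t + 1] of the integrand
    ([Kint_split]) give three facts:
    - raising [a] and [b] by one multiplies [w_c] by a constant times [x]
      ([W_shift]);
    - [(x w_c)'] is a combination of [w_c] and [w_(c+1)] with coefficients affine
      in [x] ([xW_is_derive]), and [(x w_(c+1))'] is even a constant multiple of
      [w_(c+1) - w_c] ([xW_is_derive_S]);
    - [w_(c+2)] is a combination of [w_c] and [w_(c+1)] with coefficients affine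
      in [x] ([W_contiguous]).
    Tonelli's theorem turns a moment of [w_c] into a Gamma value times a [Kint] at
    [x = 0] ([W_moment]); the recurrences of these moments in [k] and in [c]
    ([Wmoment_rec_k], [Wmoment_rec_c]) are those of [(A)_k (B)_k / (C)_k].

    Let [w1, w2] be the two weights at [(a, b, c)] and [v0, v1] the two weights at
    the raised parameters.  The facts above say that [v0, v1] and [v0', v1'] are
    combinations of [w1, w2] whose polynomial coefficients have exactly the
    degrees that advance the step-line by one.  This is recorded twice with the
    same constants: pointwise, and as relations between moment sequences
    ([pearson_moments]), where [\int x^k v' = - k \int x^(k-1) v] is a plain
    identity, so that no boundary term at infinity has to be controlled.

    Type II.  The moments of [P_(n+1)'] against [x^k v_i] become moments of
    [P_(n+1)] against [x^j w_i] which vanish; hence [P_(n+1)' / (n+1)] satisfies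
    the orthogonality conditions of the monic polynomial [P'_n].

    Type I.  If [Q = A v0 + B v1], then [- Q' = A~ w1 + B~ w2] for polynomials
    [A~], [B~] within the degree bounds of the next index, and its [k]-th moment
    is [k] times the [(k-1)]-st moment of [Q] ([momf_derivAB]).  For [Q] of
    length [n] these moments agree with those of [n Q_(n+1)] for [k <= n].

    Both parts end with the same uniqueness argument, [triangular_unique]: a
    family with one member for each index, triangular with respect to the
    moment functionals, is a basis adapted to the degree filtration, so an
    element of the [n]-th step of the filtration is determined by its first [n]
    moments. *)

(** * The fundamental theorem of calculus on the open half-line *)

Section HalfLine.
Set Implicit Arguments.
Unset Strict Implicit.
Local Open Scope classical_set_scope.
Context {R : realType}.
Local Notation mu := (@lebesgue_measure R).
Let seg (n : nat) : set R := `[n.+1%:R^-1, n.+2%:R].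

Lemma bigcup_seg : \bigcup_n seg n = `]0, +oo[.
Proof.
rewrite eqEsubset; split => x /=.
  move=> [n _]; rewrite /seg /= !in_itv/= andbT => /andP[+ _].
  by apply: lt_le_trans; rewrite invr_gt0.
rewrite in_itv/= andbT => x0.
pose n := maxn (Num.truncn x^-1) (Num.truncn x).
exists n => //=; rewrite /seg /= in_itv/=; apply/andP; split.
  rewrite -[leRHS]invrK lef_pV2 ?posrE ?invr_gt0//.
  rewrite (le_trans (ltW (truncnS_gt x^-1)))// ler_nat ltnS.
  exact: leq_maxl.
rewrite (le_trans (ltW (truncnS_gt x)))// ler_nat ltnS leqW//.
exact: leq_maxr.
Qed.

Lemma nondecreasing_seg : nondecreasing_seq seg.
Proof.
move=> m n mn; rewrite subsetEset; apply: subset_itv; rewrite bnd_simp.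
  by rewrite lef_pV2 ?posrE// ler_nat.
by rewrite ler_nat.
Qed.

Lemma seg_gt0 n x : seg n x -> 0 < x.
Proof.
by rewrite /seg/= in_itv/= => /andP[+ _]; apply: lt_le_trans; rewrite invr_gt0.
Qed.

Section FTC.
Variables (g G : R -> R) (l l0 : R).
Hypothesis dG : forall x : R, 0 < x -> is_derive x 1 G (g x).
Hypothesis cg : forall x : R, 0 < x -> {for x, continuous g}.
Hypothesis Gl : G x @[x --> +oo%R] --> l.
Hypothesis Gl0 : G x @[x --> 0^'+] --> l0.

Lemma continuous_gt0_measurable (D : set R) : measurable D -> D `<=` `]0, +oo[ ->
  measurable_fun D g.
Proof.
move=> mD D0; apply: (measurable_funS _ D0) => //.
apply: open_continuous_measurable_fun => //= x.
by rewrite inE/= in_itv/= andbT; exact: cg.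
Qed.

(** The integrands of interest blow up at 0, so the compact theorem is used on
    segments that stay away from 0 and the limit is taken at both ends. *)
Lemma FTC_seg n : (\int[mu]_(x in seg n) (g x)%:E = (G n.+2%:R - G n.+1%:R^-1)%:E)%E.
Proof.
have lt1 : (n.+1%:R^-1 < n.+2%:R :> R).
  by rewrite (@le_lt_trans _ _ 1) ?ltr1n// invf_le1 ?ler1n.
have dG' x : 0 < x -> {for x, continuous G}.
  by move=> x0; apply: differentiable_continuous; apply/derivable1_diffP; case: (dG x0).
have p0 : 0 < n.+1%:R^-1 :> R by rewrite invr_gt0.
rewrite (@continuous_FTC2 _ g G) ?EFinB//.
- apply: continuous_in_subspaceT => x.
  by rewrite inE/= => /seg_gt0; exact: cg.
- split.
  + move=> x; rewrite in_itv/= => /andP[nx _].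
    by case: (dG (lt_trans p0 nx)).
  + by apply: cvg_at_right_filter; apply: dG'.
  + by apply: cvg_at_left_filter; apply: dG'.
- move=> x; rewrite in_itv/= => /andP[nx _].
  by rewrite derive1E; case: (dG (lt_trans p0 nx)).
Qed.

Lemma FTC_seg_cvg :
  (\int[mu]_(x in seg n) (g x)%:E)%E @[n --> \oo] --> (l - l0)%:E.
Proof.
under eq_cvg do rewrite FTC_seg.
apply: cvg_EFin; first exact: nearW.
apply: cvgB.
  apply/((cvg_pinftyP _ _).1 Gl)/cvgryPge => r.
  near=> n; rewrite (@le_trans _ _ n%:R)//; first by near: n; exact: nbhs_infty_ger.
  by rewrite ler_nat; lia.
apply/((cvg_at_rightP _ _ _).1 Gl0); split => [n|]; first by rewrite invr_gt0.
exact: cvg_harmonic.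
Unshelve. all: by end_near. Qed.

Lemma ge0_FTC_half_line : (forall x, 0 < x -> 0 <= g x) ->
  (\int[mu]_(x in `]0%R, +oo[) (g x)%:E = (l - l0)%:E)%E.
Proof.
move=> g0; rewrite -bigcup_seg.
have sub n : seg n `<=` `]0, +oo[ by move=> x /seg_gt0; rewrite /= in_itv/= andbT.
apply/esym/(cvg_unique _ FTC_seg_cvg) => //.
apply: ge0_nondecreasing_set_cvg_integral => //.
- exact: nondecreasing_seg.
- by move=> n; exact: measurable_itv.
- move=> n; apply/measurable_EFinP.
  by apply: continuous_gt0_measurable; [exact: measurable_itv|exact: (sub n)].
- by move=> n x /seg_gt0 /g0; rewrite lee_fin.
Qed.

(** The source of all integrability proofs below: a nonnegative derivative of
    a function with finite limits at 0 and at infinity is integrable. *)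
Lemma ge0_FTC_integrable : (forall x, 0 < x -> 0 <= g x) ->
  mu.-integrable `]0, +oo[ (EFin \o g).
Proof.
move=> g0; apply/integrableP; split.
  apply/measurable_EFinP; apply: continuous_gt0_measurable => //.
under eq_integral => x.
  rewrite inE/= in_itv/= andbT => x0.
  rewrite ger0_norm ?g0//; over.
by rewrite ge0_FTC_half_line ?ltry.
Qed.

Lemma FTC_half_line : mu.-integrable `]0, +oo[ (EFin \o g) ->
  \int[mu]_(x in `]0, +oo[) g x = l - l0.
Proof.
move=> ig.
have sub n : seg n `<=` `]0, +oo[ by move=> x /seg_gt0; rewrite /= in_itv/= andbT.
pose h n := (EFin \o g) \_ (seg n).
have mg : measurable_fun (`]0, +oo[ : set R) (EFin \o g) := measurable_int _ ig.
have mh n : measurable_fun (`]0, +oo[ : set R) (h n).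
  apply/(measurable_restrict _ _ _).1 => //; first exact: measurable_itv.
  by apply: measurable_funS mg => //; exact: measurableI.
have dc : (\int[mu]_(x in `]0%R, +oo[) h n x)%E @[n --> \oo] -->
    (\int[mu]_(x in `]0%R, +oo[) (EFin \o g) x)%E.
  apply: (@dominated_cvg _ _ R mu `]0, +oo[ _ h (EFin \o g) (abse \o (EFin \o g))) => //.
  - move=> x x0; apply: cvg_near_cst.
    have : (\bigcup_n seg n) x by rewrite bigcup_seg.
    move=> [n _ segnx]; near=> m.
    rewrite /h patchE mem_set//.
    have /nondecreasing_seg : (n <= m)%N by near: m; exact: nbhs_infty_ge.
    by rewrite subsetEset; apply.
  - exact: integrable_abse.
  - by move=> n x _; rewrite /h patchE; case: ifPn => // _; rewrite abse0 abse_ge0.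
move: dc.
have -> : (fun n => \int[mu]_(x in `]0%R, +oo[) h n x)%E =
         (fun n => \int[mu]_(x in seg n) (g x)%:E)%E.
  apply/funext => n; rewrite /h -integral_mkcondr; congr (integral _ _ _).
  by rewrite setIidr.
move=> /cvg_lim H; rewrite /Rintegral -[X in fine X]H//.
by have /cvg_lim -> := FTC_seg_cvg.
Unshelve. all: by end_near. Qed.

End FTC.
End HalfLine.

(** * The kernel t^p (t+1)^q e^(-tx) *)
Section Kernel.
Set Implicit Arguments.
Unset Strict Implicit.
Local Open Scope classical_set_scope.
Context {R : realType}.
Implicit Types p q x t u v : R.

Definition kern p q x t : R := t `^ p * (t + 1) `^ q * expR (- (t * x)).

Lemma kern_ge0 p q x t : 0 <= kern p q x t.
Proof. by rewrite !mulr_ge0 ?powR_ge0 ?expR_ge0. Qed.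

Lemma gt0_powRE u r : 0 < u -> u `^ r = expR (r * ln u).
Proof. by move=> u0; rewrite /powR gt_eqF. Qed.

Lemma powR_subr1 u r : 0 < u -> u * u `^ (r - 1) = u `^ r.
Proof.
move=> u0; have un0 : u != 0 by rewrite gt_eqF.
by rewrite powRB ?un0 ?implybT// powRr1 ?ltW// mulrC divfK.
Qed.

Lemma kern_shift_t p q x t : 0 < t -> t * kern p q x t = kern (p + 1) q x t.
Proof.
by move=> t0; rewrite /kern -[in RHS](powR_subr1 _ t0) addrK; ring.
Qed.

Lemma kern_shift_t1 p q x t : 0 < t -> (t + 1) * kern p q x t = kern p (q + 1) x t.
Proof.
move=> t0; have t1 : 0 < t + 1 by rewrite addr_gt0.
by rewrite /kern -[in RHS](powR_subr1 _ t1) addrK; ring.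
Qed.

Lemma shift_powR_is_derive q t : 0 < t + 1 ->
  is_derive t 1 (fun t : R => (t + 1) `^ q) (q * (t + 1) `^ (q - 1)).
Proof.
move=> t1; have d := is_derive1_powR q t1.
have := @is_derive1_comp R (fun u => u `^ q) (fun t => t + 1) t _ _ d
    (is_deriveD (is_derive_id t 1) (is_derive_cst (1 : R) t 1)).
by rewrite addr0 mulr1.
Qed.

Lemma kern_is_derive p q x t : 0 < t ->
  is_derive t 1 (kern p q x)
    (p * kern (p - 1) q x t + q * kern p (q - 1) x t - x * kern p q x t).
Proof.
move=> t0; have t1 : 0 < t + 1 by rewrite addr_gt0.
have d1 := is_derive1_powR p t0.
have d2 := shift_powR_is_derive q t1.
have d3 : is_derive t 1 (fun t : R => expR (- (t * x))) (- x * expR (- (t * x))).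
  have d : is_derive t 1 (fun t : R => - (t * x)) (- x).
    apply: is_derive_eq; by rewrite scaler0 add0r scaler1.
  have := @is_derive1_comp R expR (fun t => - (t * x)) t _ _ (is_derive_expR _) d.
  by rewrite mulrC.
have d := is_deriveM (is_deriveM d1 d2) d3.
apply: is_derive_eq.
by rewrite /kern /= fctE /GRing.scale/=; ring.
Qed.

Lemma kern_continuous p q x t : 0 < t -> {for t, continuous (kern p q x)}.
Proof.
move=> t0; apply: differentiable_continuous; apply/derivable1_diffP.
by case: (kern_is_derive p q x t0).
Qed.

(** Makes powers of [t] and of [t + 1] comparable for [t >= 1], and powers of
    [t + 1] comparable to 1 for [t <= 1], whatever the sign of the exponent. *)
Lemma powR_le_double u v r : 0 < u -> u <= v -> v <= 2 * u ->
  u `^ r <= 2 `^ `|r| * v `^ r /\ v `^ r <= 2 `^ `|r| * u `^ r.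
Proof.
move=> u0 uv v2u; have v0 : 0 < v by exact: lt_le_trans uv.
have l1 : ln u <= ln v by rewrite ler_ln.
have l2 : ln v <= ln 2 + ln u.
  by rewrite -lnM ?posrE// ler_ln// posrE mulr_gt0.
have key : `|r * (ln v - ln u)| <= `|r| * ln 2.
  by rewrite normrM ler_wpM2l// ger0_norm ?subr_ge0// lerBlDr.
have := ler_norm (r * (ln v - ln u)).
have := ler_norm (- (r * (ln v - ln u))).
rewrite normrN !gt0_powRE// -!expRD !ler_expR => h1 h2.
by split; lra.
Qed.

Lemma powR_expR_bounded r x : 0 < x ->
  exists C, forall t, 0 < t -> (t + 1) `^ r * expR (- (t * x)) <= C.
Proof.
move=> x0; pose M := `|r| + 1.
have M0 : 0 < M by rewrite ltr_wpDl.
(* From ln y <= y - 1 at y = (t + 1) x / M, multiplied by M. *)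
exists (expR (x - M - M * ln (x / M))).
move=> t t0; have t1 : 0 < t + 1 by rewrite addr_gt0.
have xM0 : 0 < x / M by rewrite divr_gt0.
rewrite gt0_powRE// -expRD ler_expR.
have l0 : 0 <= ln (t + 1) by rewrite ln_ge0// lerDr ltW.
have rM : r * ln (t + 1) <= M * ln (t + 1).
  by rewrite ler_wpM2r// /M (le_trans (ler_norm r))// lerDl.
have : ln (t + 1) + ln (x / M) <= (t + 1) * (x / M) - 1.
  rewrite -lnM ?posrE// -[X in ln X](subrKC 1).
  by apply: le_ln1Dx; rewrite ltrBrDl subrr mulr_gt0.
rewrite -(ler_pM2l M0) mulrDr mulrBr mulr1.
have -> : M * ((t + 1) * (x / M)) = (t + 1) * x by field; rewrite gt_eqF.
lra.
Qed.

Lemma shift_powR_cvg0 e : 0 < e -> (t + 1) `^ (- e) @[t --> +oo] --> (0 : R).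
Proof.
move=> e0; apply/cvgrPdist_lt => /= d d0.
near=> t.
have t1 : 0 < t + 1 by rewrite addr_gt0//; near: t; exact: nbhs_pinfty_gt.
rewrite sub0r normrN ger0_norm ?powR_ge0// gt0_powRE// -[ltRHS](lnK d0) ltr_expR.
rewrite mulNr ltrNl -ltr_pdivrMl//.
rewrite -[ltLHS]expRK ltr_ln ?posrE ?expR_gt0//.
rewrite -ltrBlDr; near: t; exact: nbhs_pinfty_gt.
Unshelve. all: by end_near. Qed.

Lemma kern_cvg0_at0 p q x : 0 < p -> kern p q x t @[t --> 0^'+] --> 0.
Proof.
move=> p0; rewrite -[X in _ --> X](mul0r (expR (- (0 * x)))).
apply: cvgM; last first.
  apply: cvg_at_right_filter; apply: continuous_comp; last exact: continuous_expR.
  by apply: continuousN; apply: continuousM; [exact: cvg_id|exact: cvg_cst].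
rewrite -[X in _ --> X](mul0r ((0 + 1) `^ q)).
apply: cvgM; first exact: powR_cvg0.
apply: cvg_at_right_filter.
suff : {for 0, continuous (fun t : R => (t + 1) `^ q)} by [].
apply: differentiable_continuous; apply/derivable1_diffP.
have /(shift_powR_is_derive q)[] : (0 : R) < 0 + 1 by rewrite add0r.
by [].
Qed.

Lemma powR_le_shift p t : 0 <= p -> 0 < t -> t `^ p <= (t + 1) `^ p.
Proof.
by move=> p0 t0; rewrite ge0_ler_powR// ?nnegrE ?addr_ge0 ?lerDl// ltW.
Qed.

Lemma kern_cvg0_pinfty p q x : 0 < p -> 0 < x \/ (x = 0 /\ p + q < 0) ->
  kern p q x t @[t --> +oo] --> 0.
Proof.
move=> p0 hx.
(* A power of t + 1 to spare comes from the exponential or from p + q < 0. *)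
have [e [C [e0 leC]]] : exists e C, 0 < e /\
    forall t, 0 < t -> kern p q x t <= C * (t + 1) `^ (- e).
  case: hx => [x0|[-> pq]].
    have [C hC] := powR_expR_bounded (p + q + 1) x0.
    exists 1, C; split => // t t0.
    have t1 : 0 < t + 1 by rewrite addr_gt0.
    apply: (@le_trans _ _ ((t + 1) `^ p * (t + 1) `^ q * expR (- (t * x)))).
      by rewrite /kern !ler_wpM2r ?powR_ge0 ?expR_ge0// powR_le_shift// ltW.
    apply: le_trans (ler_wpM2r (powR_ge0 _ _) (hC t t0)).
    rewrite !gt0_powRE// -!expRD ler_expR; lra.
  exists (- (p + q)), 1; split; first by rewrite oppr_gt0.
  move=> t t0; rewrite /kern mulr0 oppr0 expR0 mulr1 mul1r opprK powRD; last first.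
    by rewrite (gt_eqF (addr_gt0 t0 ltr01)) implybT.
  by rewrite ler_wpM2r ?powR_ge0// powR_le_shift// ltW.
have up : C * (t + 1) `^ (- e) @[t --> +oo] --> (0 : R).
  rewrite -[X in _ --> X](mulr0 C); apply: cvgM; first exact: cvg_cst.
  exact: shift_powR_cvg0.
apply: (squeeze_cvgr _ (cvg_cst 0) up).
by near=> t; rewrite kern_ge0/= leC//; near: t; exact: nbhs_pinfty_gt.
Unshelve. all: by end_near. Qed.

End Kernel.

(** * The integral of the kernel *)

(** Locked: otherwise comparing two such integrals, as [ring] does, unfolds them
    down to the construction of the Lebesgue integral. *)
HB.lock Definition Kint {R : realType} (p q x : R) : R :=
  \int[@lebesgue_measure R]_(t in `]0, +oo[%classic) kern p q x t.

Section KernelIntegral.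
Set Implicit Arguments.
Unset Strict Implicit.
Local Open Scope classical_set_scope.
Context {R : realType}.
Local Notation mu := (@lebesgue_measure R).
Implicit Types p q x t u v s : R.

Lemma kern_measurable p q x : measurable_fun (`]0, +oo[ : set R) (kern p q x).
Proof.
by apply: continuous_gt0_measurable => //; move=> t; exact: kern_continuous.
Qed.

Lemma integrable_dominated (f g : R -> R) C :
  measurable_fun (`]0, +oo[ : set R) f ->
  mu.-integrable `]0, +oo[ (EFin \o g) ->
  (forall t, 0 < t -> `|f t| <= C * g t) ->
  mu.-integrable `]0, +oo[ (EFin \o f).
Proof.
move=> mf ig fg.
have iCg : mu.-integrable `]0, +oo[ (fun t => C%:E * (g t)%:E)%E.
  by apply: integrableZl => //; exact: measurable_itv.
apply: le_integrable iCg => //.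
  exact/measurable_EFinP.
move=> t; rewrite /= in_itv/= andbT => t0.
by rewrite lee_fin (le_trans (fg _ t0))// ler_norm.
Qed.

(** Up to the factor [p + 1], this kernel is the derivative of
    [(t / (t + 1))^(p+1)], which increases from 0 to 1: it has the right
    singularity at 0 and decays as [t^-2]. *)
Lemma kern_integrable_balanced p : -1 < p ->
  mu.-integrable `]0, +oo[ (EFin \o kern p (- p - 2) 0).
Proof.
move=> p1; have p0 : 0 < p + 1 by lra.
have cvg1 : kern (p + 1) (- (p + 1)) 0 t @[t --> +oo] --> (1 : R).
  rewrite [X in _ --> X](_ : _ = (1 - 0) `^ (p + 1)); last by rewrite subr0 powR1.
  have lim1 : (1 - (t + 1) `^ (- 1)) `^ (p + 1) @[t --> +oo] --> ((1 - 0) `^ (p + 1) : R).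
    apply: (@continuous_cvg _ _ _ _ _ (fun t : R => 1 - (t + 1) `^ (- 1))
      (fun u : R => u `^ (p + 1)) (1 - 0)); last first.
      by apply: cvgB; [exact: cvg_cst|exact: shift_powR_cvg0].
    rewrite subr0; apply: differentiable_continuous; apply/derivable1_diffP.
    by case: (is_derive1_powR (p + 1) (ltr01 : 0 < 1 :> R)).
  apply: cvg_trans lim1; apply: near_eq_cvg; near=> t.
  have t0 : 0 < t by near: t; exact: nbhs_pinfty_gt.
  have t1 : 0 < t + 1 by rewrite addr_gt0.
  rewrite powR_inv1 ?ltW//.
  have -> : 1 - (t + 1)^-1 = t / (t + 1) by field; rewrite gt_eqF.
  rewrite /kern powRM ?invr_ge0 ?(ltW t0) ?(ltW t1)// mulr0 oppr0 expR0 mulr1.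
  by rewrite -(powR_inv1 (ltW t1)) -powRrM mulN1r.
have int1 : mu.-integrable `]0, +oo[ (EFin \o (fun t => (p + 1) * kern p (- p - 2) 0 t)).
  apply: (@ge0_FTC_integrable _ _ (kern (p + 1) (- (p + 1)) 0) 1 0) => //.
  - move=> t t0; apply: is_derive_eq (kern_is_derive _ _ _ t0) _.
    rewrite addrK -(kern_shift_t _ _ _ t0).
    have -> : - (p + 1) - 1 = - p - 2 by ring.
    have -> : - (p + 1) = - p - 2 + 1 by ring.
    rewrite -(kern_shift_t1 _ _ _ t0); ring.
  - move=> t t0; apply: continuousM; first exact: cvg_cst.
    exact: kern_continuous.
  - exact: kern_cvg0_at0.
  - by move=> t t0; rewrite mulr_ge0 ?kern_ge0 ?ltW.
apply: (integrable_dominated (C := (p + 1)^-1) (kern_measurable _ _ _) int1).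
by move=> t t0; rewrite ger0_norm ?kern_ge0// mulKf// gt_eqF.
Unshelve. all: by end_near. Qed.

(** Up to the factor [e], the derivative of [- (t + 1)^-e]; it supplies the slow
    decay that the previous kernel lacks. *)
Lemma kern_integrable_tail e : 0 < e ->
  mu.-integrable `]0, +oo[ (EFin \o kern 0 (- e - 1) 0).
Proof.
move=> e0.
have int1 : mu.-integrable `]0, +oo[ (EFin \o (fun t => e * kern 0 (- e - 1) 0 t)).
  apply: (@ge0_FTC_integrable _ _ (fun t => - kern 0 (- e) 0 t) 0 (- 1)) => //.
  - move=> t t0; apply: is_derive_eq (is_deriveN (kern_is_derive _ _ _ t0)) _.
    ring.
  - move=> t t0; apply: continuousM; first exact: cvg_cst.
    exact: kern_continuous.
  - rewrite -[X in _ --> X]oppr0; apply: cvgN.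
    rewrite /kern; under eq_fun do rewrite powRr0 mul1r mulr0 oppr0 expR0 mulr1.
    exact: shift_powR_cvg0.
  - apply: cvgN.
    rewrite /kern; under eq_fun do rewrite powRr0 mul1r mulr0 oppr0 expR0 mulr1.
    apply: cvg_at_right_filter.
    rewrite [X in _ --> X](_ : _ = (0 + 1) `^ (- e)); last by rewrite add0r powR1.
    suff : {for 0, continuous (fun t : R => (t + 1) `^ (- e))} by [].
    apply: differentiable_continuous; apply/derivable1_diffP.
    have /(shift_powR_is_derive (- e))[] : (0 : R) < 0 + 1 by rewrite add0r.
    by [].
  - by move=> t t0; rewrite mulr_ge0 ?kern_ge0 ?ltW.
apply: (integrable_dominated (C := e^-1) (kern_measurable _ _ _) int1).
by move=> t t0; rewrite ger0_norm ?kern_ge0// mulKf// gt_eqF.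
Qed.

(** With a positive [x] the exponential absorbs any power of [t + 1] and the
    balanced kernel dominates.  With [x = 0] it dominates on [(0, 1]], and the
    tail kernel dominates beyond 1. *)
Lemma kern_integrable p q x : -1 < p -> 0 < x \/ (x = 0 /\ p + q < -1) ->
  mu.-integrable `]0, +oo[ (EFin \o kern p q x).
Proof.
move=> p1 [x0|[-> pq]].
  have [C hC] := powR_expR_bounded (q + p + 2) x0.
  apply: (integrable_dominated (C := C) (kern_measurable _ _ _) (kern_integrable_balanced p1)).
  move=> t t0; rewrite ger0_norm ?kern_ge0//.
  apply: le_trans (ler_wpM2r (kern_ge0 _ _ _ _) (hC t t0)).
  rewrite /kern mulr0 oppr0 expR0 !gt0_powRE// ?addr_gt0// -!expRD mulr1 -!expRD.
  rewrite ler_expR; lra.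
have [e [e0 qE]] : exists e, 0 < e /\ q = - e - 1 - p.
  by exists (- 1 - p - q); split; lra.
pose C := 2 `^ `|q + p + 2| + 2 `^ `|p|.
have i2 : mu.-integrable `]0, +oo[
    (fun t => (kern p (- p - 2) 0 t)%:E + (kern 0 (- e - 1) 0 t)%:E)%E.
  apply: integrableD; first exact: measurable_itv.
    exact: kern_integrable_balanced.
  exact: kern_integrable_tail.
apply: (integrable_dominated (C := C) (kern_measurable _ _ _) i2).
move=> t t0; rewrite ger0_norm ?kern_ge0//=.
have t1 : 0 < t + 1 by rewrite addr_gt0.
apply: (@le_trans _ _ (2 `^ `|q + p + 2| * kern p (- p - 2) 0 t +
    2 `^ `|p| * kern 0 (- e - 1) 0 t)); last first.
  rewrite /C mulrDr !mulrDl.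
  have := mulr_ge0 (powR_ge0 2 `|p|) (kern_ge0 p (- p - 2) 0 t).
  have := mulr_ge0 (powR_ge0 2 `|q + p + 2|) (kern_ge0 0 (- e - 1) 0 t).
  lra.
have [tle1|/ltW tge1] := leP t 1.
  apply: ler_wpDr; first by rewrite mulr_ge0 ?powR_ge0 ?kern_ge0.
  have h1 : 1 <= t + 1 by lra.
  have h2 : t + 1 <= 2 * 1 by lra.
  have [_] := powR_le_double (q + p + 2) ltr01 h1 h2.
  rewrite powR1 mulr1 => h.
  apply: le_trans (ler_wpM2r (kern_ge0 _ _ _ _) h).
  rewrite /kern mulr0 oppr0 expR0 !mulr1 !gt0_powRE// -!expRD ler_expR; lra.
apply: ler_wpDl; first by rewrite mulr_ge0 ?powR_ge0 ?kern_ge0.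
have h1 : t <= t + 1 by lra.
have h2 : t + 1 <= 2 * t by lra.
have [h _] := powR_le_double p t0 h1 h2.
rewrite /kern mulr0 oppr0 expR0 !mulr1 powRr0 mul1r.
apply: le_trans (ler_wpM2r (powR_ge0 _ _) h) _.
rewrite -mulrA ler_wpM2l ?powR_ge0// !gt0_powRE// -!expRD ler_expR qE; lra.
Qed.

Lemma KintE p q x : Kint p q x = \int[mu]_(t in `]0, +oo[) kern p q x t.
Proof. by rewrite Kint.unlock. Qed.

Lemma Kint_ge0 p q x : 0 <= Kint p q x.
Proof. by rewrite KintE; apply: Rintegral_ge0 => t _; exact: kern_ge0. Qed.

Lemma Kint_EFin p q x : -1 < p -> 0 < x \/ (x = 0 /\ p + q < -1) ->
  (\int[mu]_(t in `]0%R, +oo[) (kern p q x t)%:E)%E = (Kint p q x)%:E.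
Proof.
move=> hp hx; rewrite KintE /Rintegral fineK//.
by apply: integrable_fin_num => //; exact: kern_integrable.
Qed.

Lemma Kint_split p q x : -1 < p -> 0 < x \/ (x = 0 /\ p + q < -2) ->
  Kint p (q + 1) x = Kint p q x + Kint (p + 1) q x.
Proof.
move=> hp hx; rewrite !KintE -RintegralD//.
- apply: eq_Rintegral => t; rewrite inE/= in_itv/= andbT => t0.
  by rewrite -(kern_shift_t1 _ _ _ t0) -(kern_shift_t _ _ _ t0) mulrDl mul1r addrC.
- apply: kern_integrable => //; case: hx => [|[-> ?]]; [by left|right; split => //; lra].
- apply: kern_integrable; first lra.
  by case: hx => [|[-> ?]]; [left|right; split => //; lra].
Qed.

(** The integral of the derivative of [kern p q x], which tends to 0 at both
    ends.  The right-hand side makes sense at [x = 0] even where [kern p q 0] is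
    not integrable. *)
Lemma Kint_by_parts p q x : 0 < p -> 0 < x \/ (x = 0 /\ p + q < 0) ->
  p * Kint (p - 1) q x + q * Kint p (q - 1) x = x * Kint p q x.
Proof.
move=> p0 hx.
have iZ c f : mu.-integrable `]0, +oo[ (EFin \o f) ->
    mu.-integrable `]0, +oo[ (EFin \o (fun t => c * f t)).
  by move=> fi; apply: (integrableZl _ c fi) => //; exact: measurable_itv.
have i1 : mu.-integrable `]0, +oo[ (EFin \o kern (p - 1) q x).
  by apply: kern_integrable; [lra|case: hx => [|[]]; [left|right; split => //; lra]].
have i2 : mu.-integrable `]0, +oo[ (EFin \o kern p (q - 1) x).
  by apply: kern_integrable; [lra|case: hx => [|[]]; [left|right; split => //; lra]].
have [i3 E3] : mu.-integrable `]0, +oo[ (EFin \o (fun t => x * kern p q x t)) /\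
    \int[mu]_(t in `]0, +oo[) (x * kern p q x t) = x * Kint p q x.
  case: hx => [x0|[-> _]].
    have i3 : mu.-integrable `]0, +oo[ (EFin \o kern p q x).
      by apply: kern_integrable; [lra|left].
    by split; [exact: iZ|rewrite KintE RintegralZl].
  (* Here p + q < 0 alone does not make kern p q 0 integrable. *)
  have -> : (fun t => 0 * kern p q 0 t) = cst 0 by apply/funext => t; rewrite mul0r.
  split; first exact: integrable0.
  by rewrite mul0r /Rintegral integral0.
have i12 : mu.-integrable `]0, +oo[
    (EFin \o (fun t => p * kern (p - 1) q x t + q * kern p (q - 1) x t)).
  by apply: (integrableD _ (iZ p _ i1) (iZ q _ i2)); exact: measurable_itv.
have : \int[mu]_(t in `]0, +oo[)
    (p * kern (p - 1) q x t + q * kern p (q - 1) x t - x * kern p q x t) = 0 - 0.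
  apply: (@FTC_half_line _ _ (kern p q x)).
  - by move=> t t0; exact: kern_is_derive.
  - move=> t t0; apply: continuousB; [apply: continuousD|].
    + by apply: continuousM; [exact: cvg_cst|exact: kern_continuous].
    + by apply: continuousM; [exact: cvg_cst|exact: kern_continuous].
    + by apply: continuousM; [exact: cvg_cst|exact: kern_continuous].
  - exact: kern_cvg0_pinfty.
  - exact: kern_cvg0_at0.
  - by apply: (integrableB _ i12 i3); exact: measurable_itv.
rewrite subr0 RintegralB// E3 RintegralD//; [|exact: iZ..].
rewrite !RintegralZl// -!KintE => /eqP.
by rewrite subr_eq0 => /eqP.
Qed.

Lemma Kint_is_derive p q x : -1 < p -> 0 < x ->
  is_derive x 1 (Kint p q) (- Kint (p + 1) q x).
Proof.
move=> p1 x0.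
pose f y t := kern p q y t.
rewrite (_ : Kint p q = fun y => \int[mu]_(t in `]0, +oo[) f y t); last first.
  by apply/funext => y; rewrite KintE.
have df (y t : R) : is_derive y 1 (f ^~ t) (- (t * kern p q y t)).
  have d : is_derive y 1 (fun y : R => - (t * y)) (- t).
    by apply: is_derive_eq; rewrite /GRing.scale/= mulr1.
  have := is_deriveM (is_derive_cst (t `^ p * (t + 1) `^ q) y 1)
    (@is_derive1_comp R expR (fun y => - (t * y)) y _ _ (is_derive_expR _) d).
  rewrite scaler0 addr0 => d'.
  apply: is_derive_eq d' _; rewrite /kern /GRing.scale/=; ring.
have pd (y t : R) : partial1of2 f y t = - (t * kern p q y t).
  by rewrite partial1of2E; case: (df y t).
have Ia : (`]x / 2, x + 1[ : set R) x by rewrite /= in_itv/=; lra.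
have intf (y : R) : (`]x / 2, x + 1[ : set R) y -> mu.-integrable `]0, +oo[ (EFin \o f y).
  rewrite /= in_itv/= => /andP[hy _]; apply: kern_integrable => //; left; lra.
have derf (y t : R) : (`]x / 2, x + 1[ : set R) y -> (`]0, +oo[ : set R) t ->
    derivable (f ^~ t) y 1.
  by move=> _ _; case: (df y t).
have intG : mu.-integrable `]0, +oo[ (EFin \o kern (p + 1) q (x / 2)).
  apply: kern_integrable => //; first lra.
  left; lra.
(* Dominating by the value at x / 2 is uniform over the neighbourhood of x. *)
have ubG (y t : R) : (`]x / 2, x + 1[ : set R) y -> (`]0, +oo[ : set R) t ->
   `|partial1of2 f y t| <= kern (p + 1) q (x / 2) t.
  rewrite /= !in_itv/= andbT => /andP[hy _] t0.
  rewrite pd normrN kern_shift_t// ger0_norm ?kern_ge0//.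
  rewrite /kern ler_wpM2l ?mulr_ge0 ?powR_ge0// ler_expR lerN2 ler_wpM2l//; lra.
have D := derivable_under_integral _ Ia intf derf (kern_ge0 _ _ _) intG ubG.
have V := differentiation_under_integral _ Ia intf derf (kern_ge0 _ _ _) intG ubG.
apply: DeriveDef; first by apply: D; exact: measurable_itv.
rewrite -derive1E V; last exact: measurable_itv.
rewrite -[RHS]mulN1r KintE -RintegralZl//; last by apply: kern_integrable; [lra|left].
apply: eq_Rintegral => t; rewrite inE/= in_itv/= andbT => t0.
by rewrite pd kern_shift_t// mulN1r.
Qed.

Lemma derive0_gt0_cst (f : R -> R) : (forall y : R, 0 < y -> is_derive y 1 f 0) ->
  forall u v, 0 < u -> 0 < v -> f u = f v.
Proof.
move=> df; suff lt_eq u v : 0 < u -> u < v -> f u = f v.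
  move=> u v u0 v0; have [uv|vu|->//] := ltgtP u v; first exact: lt_eq.
  by apply/esym/lt_eq.
move=> u0 uv.
have dfu (y : R) : y \in `]u, v[%R -> is_derive y 1 f 0.
  by rewrite in_itv/= => /andP[uy _]; exact: df (lt_trans u0 uy).
have cf : {within `[u, v], continuous f}.
  apply: derivable_within_continuous => y; rewrite /= in_itv/= => /andP[uy _].
  by case: (df _ (lt_le_trans u0 uy)).
have [c _] := @MVT R f (fun=> 0) u v uv dfu cf.
by rewrite mul0r => /eqP; rewrite subr_eq0 => /eqP.
Qed.

Lemma Kint_GammaE s : Gamma s = Kint (s - 1) 0 1.
Proof.
by rewrite KintE; apply: eq_Rintegral => t _; rewrite /kern powRr0 !mulr1.
Qed.

Lemma Gamma_rec s : 0 < s -> Gamma (s + 1) = s * Gamma s.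
Proof.
move=> s0; rewrite !Kint_GammaE addrK.
have := @Kint_by_parts s 0 1 s0 (or_introl ltr01).
by rewrite mul0r addr0 mul1r => <-.
Qed.

(** Obtained without a change of variables: by [Kint_is_derive] and
    [Kint_by_parts], [y^s Kint (s - 1) 0 y] has derivative 0. *)
Lemma Kint_scaling s y : 0 < s -> 0 < y -> Kint (s - 1) 0 y = y `^ (- s) * Gamma s.
Proof.
move=> s0 y0.
have dphi (z : R) : 0 < z -> is_derive z 1 (fun z => z `^ s * Kint (s - 1) 0 z) 0.
  move=> z0.
  have dK : is_derive z 1 (Kint (s - 1) 0) (- Kint (s - 1 + 1) 0 z).
    by apply: Kint_is_derive => //; lra.
  apply: is_derive_eq (is_deriveM (is_derive1_powR s z0) dK) _.
  have := @Kint_by_parts s 0 z s0 (or_introl z0).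
  rewrite mul0r addr0 subrK /GRing.scale/= => h.
  by rewrite mulrA [Kint (s - 1) 0 z * s]mulrC h -[X in X * - _](powR_subr1 s z0); ring.
have := derive0_gt0_cst dphi y0 ltr01.
rewrite powR1 mul1r -Kint_GammaE => <-.
by rewrite mulrA -powRD ?addNr ?powRr0 ?mul1r// (gt_eqF y0) implybT.
Qed.

End KernelIntegral.

(** * The weights *)
Section Weight.
Set Implicit Arguments.
Unset Strict Implicit.
Local Open Scope classical_set_scope.
Context {R : realType}.
Implicit Types a b c s x t : R.

Definition Wcst a b c : R := Gamma (c + b + 1) / (Gamma (a + 1) * Gamma (b + 1)) / Gamma c.

Lemma W_kern a b c x :
  W a b c x = Wcst a b c * expR (- x) * x `^ a * Kint (c - 1) (a - b - c) x.
Proof.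
rewrite /W /Tricomi /Wcst.
have -> : a - b + 1 - c - 1 = a - b - c by ring.
by rewrite KintE /kern; move: (Rintegral _ _ _) => I; ring.
Qed.

Lemma Wcst_rec_c a b c : -1 < b -> 0 < c ->
  Wcst a b (c + 1) = (c + b + 1) / c * Wcst a b c.
Proof.
move=> b1 c0; rewrite /Wcst (Gamma_rec c0).
have -> : c + 1 + b + 1 = c + b + 1 + 1 by ring.
rewrite Gamma_rec; last lra.
rewrite !invfM.
by move: (Gamma c) (Gamma (a + 1)) (Gamma (b + 1)) (Gamma (c + b + 1)) => *; ring.
Qed.

Lemma Wcst_rec_ab a b c : -1 < a -> -1 < b -> 0 < c ->
  Wcst (a + 1) (b + 1) c = (c + b + 1) / ((a + 1) * (b + 1)) * Wcst a b c.
Proof.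
move=> a1 b1 c0; rewrite /Wcst.
have -> : c + (b + 1) + 1 = c + b + 1 + 1 by ring.
rewrite (@Gamma_rec _ (c + b + 1)) ?(@Gamma_rec _ (a + 1)) ?(@Gamma_rec _ (b + 1)); [|lra..].
rewrite !invfM.
by move: (Gamma c) (Gamma (a + 1)) (Gamma (b + 1)) (Gamma (c + b + 1)) => *; ring.
Qed.

(** The Tricomi factor depends on [a] and [b] only through [a - b]. *)
Lemma W_shift a b c x : -1 < a -> -1 < b -> 0 < c -> 0 < x ->
  W (a + 1) (b + 1) c x = (c + b + 1) / ((a + 1) * (b + 1)) * (x * W a b c x).
Proof.
move=> a1 b1 c0 x0; rewrite !W_kern Wcst_rec_ab// -(powR_subr1 (a + 1) x0) addrK.
have -> : a + 1 - (b + 1) - c = a - b - c by ring.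
ring.
Qed.

Lemma Wkern_is_derive a c q K x : 0 < c -> 0 < x ->
  is_derive x 1 (fun x => K * expR (- x) * x `^ (a + 1) * Kint (c - 1) q x)
  (K * expR (- x) * x `^ a * ((a + 1 - x) * Kint (c - 1) q x - x * Kint c q x)).
Proof.
move=> c0 x0.
have dK : is_derive x 1 (Kint (c - 1) q) (- Kint (c - 1 + 1) q x).
  by apply: Kint_is_derive => //; lra.
have d := @is_derive1_comp R expR (fun y => - y) x _ _ (is_derive_expR _) (is_deriveNid x 1).
have := is_deriveM (is_deriveM (is_deriveM (is_derive_cst K x 1) d)
  (is_derive1_powR (a + 1) x0)) dK.
move=> D; apply: is_derive_eq D _.
rewrite /GRing.scale/= !fctE/= subrK addrK -(powR_subr1 (a + 1) x0) addrK; ring.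
Qed.

Lemma Kint_parts_W a b c x : 0 < c -> 0 < x ->
  c * Kint (c - 1) (a - b - c) x + (a - b - c) * Kint c (a - b - (c + 1)) x
    = x * Kint c (a - b - c) x.
Proof.
move=> c0 x0; rewrite -(Kint_by_parts (q := a - b - c) c0 (or_introl x0)).
by have -> : a - b - (c + 1) = a - b - c - 1 by ring.
Qed.

(** The derivative of the Tricomi factor brings [Kint c (a - b - c)], which
    integration by parts in [t] expresses through the integrals in [W a b c] and
    [W a b (c + 1)]. *)
Lemma xW_is_derive a b c x : -1 < b -> 0 < c -> 0 < x ->
  is_derive x 1 (fun x => x * W a b c x)
   ((a + 1 - c - x) * W a b c x - (a - b - c) * c / (c + b + 1) * W a b (c + 1) x).
Proof.
move=> b1 c0 x0.
apply: near_eq_is_derive; last first.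
  apply: is_derive_eq (Wkern_is_derive a (a - b - c) (Wcst a b c) c0 x0) _.
  rewrite -(Kint_parts_W a b c0 x0) !W_kern Wcst_rec_c// addrK.
  by field; apply/andP; split; rewrite gt_eqF//; lra.
near=> y; have y0 : 0 < y by near: y; exact: lt_nbhsr.
by rewrite W_kern -(powR_subr1 (a + 1) y0) addrK; ring.
Unshelve. all: by end_near. Qed.

(** At [c + 1] the same derivative can instead be expressed through [c] and
    [c + 1], and then the term in [x] cancels. *)
Lemma xW_is_derive_S a b c x : -1 < b -> 0 < c -> 0 < x ->
  is_derive x 1 (fun x => x * W a b (c + 1) x)
   ((c + b + 1) * (W a b (c + 1) x - W a b c x)).
Proof.
move=> b1 c0 x0; have c1 : 0 < c + 1 by lra.
apply: near_eq_is_derive; last first.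
  apply: is_derive_eq (Wkern_is_derive a (a - b - (c + 1)) (Wcst a b (c + 1)) c1 x0) _.
  have h : x * Kint (c + 1) (a - b - (c + 1)) x =
      c * Kint (c - 1) (a - b - c) x + (a - b - c) * Kint c (a - b - (c + 1)) x
      - x * Kint c (a - b - (c + 1)) x.
    rewrite (Kint_parts_W a b c0 x0).
    have -> : a - b - c = a - b - (c + 1) + 1 by ring.
    rewrite Kint_split; [ring|lra|by left].
  rewrite h !W_kern Wcst_rec_c// addrK.
  by field; rewrite gt_eqF.
near=> y; have y0 : 0 < y by near: y; exact: lt_nbhsr.
by rewrite W_kern -(powR_subr1 (a + 1) y0) addrK; ring.
Unshelve. all: by end_near. Qed.

Lemma Wshift_is_derive a b c x : -1 < a -> -1 < b -> 0 < c -> 0 < x ->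
  is_derive x 1 (W (a + 1) (b + 1) c)
   ((c + b + 1) / ((a + 1) * (b + 1)) *
    ((a + 1 - c - x) * W a b c x - (a - b - c) * c / (c + b + 1) * W a b (c + 1) x)).
Proof.
move=> a1 b1 c0 x0.
have d := is_deriveZ ((c + b + 1) / ((a + 1) * (b + 1))) (xW_is_derive a b1 c0 x0).
apply: near_eq_is_derive d.
near=> y; have y0 : 0 < y by near: y; exact: lt_nbhsr.
by rewrite W_shift.
Unshelve. all: by end_near. Qed.

Lemma Wshift_is_derive_S a b c x : -1 < a -> -1 < b -> 0 < c -> 0 < x ->
  is_derive x 1 (W (a + 1) (b + 1) (c + 1))
   ((c + b + 2) / ((a + 1) * (b + 1)) *
    ((c + b + 1) * (W a b (c + 1) x - W a b c x))).
Proof.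
move=> a1 b1 c0 x0.
have d := is_deriveZ ((c + b + 2) / ((a + 1) * (b + 1))) (xW_is_derive_S a b1 c0 x0).
apply: near_eq_is_derive d.
near=> y; have y0 : 0 < y by near: y; exact: lt_nbhsr.
rewrite W_shift//; last lra.
by rewrite /GRing.scale/=; congr (_ / _ * _); ring.
Unshelve. all: by end_near. Qed.

(** The two preceding lemmas compute the same derivative of [x W a b (c + 1)]. *)
Lemma W_contiguous a b c x : -1 < b -> 0 < c -> 0 < x ->
  (a - b - (c + 1)) * (c + 1) / (c + b + 2) * W a b (c + 2) x =
  (a - b - 2 * c - 1 - x) * W a b (c + 1) x + (c + b + 1) * W a b c x.
Proof.
move=> b1 c0 x0.
have c1 : 0 < c + 1 by lra.
have [_ e1] := xW_is_derive a b1 c1 x0.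
have [_ ] := xW_is_derive_S a b1 c0 x0.
rewrite e1.
have -> : c + 1 + 1 = c + 2 by ring.
have -> : c + 1 + b + 1 = c + b + 2 by ring.
move: (W a b c x) (W a b (c + 1) x) (W a b (c + 2) x) => w0 w1 w2.
move: (_ / (c + b + 2)) => r h; lra.
Qed.

Lemma W_continuous a b c x : 0 < c -> 0 < x -> {for x, continuous (W a b c)}.
Proof.
move=> c0 x0; apply: differentiable_continuous; apply/derivable1_diffP.
have [+ _] := Wkern_is_derive (a - 1) (a - b - c) (Wcst a b c) c0 x0.
rewrite subrK; apply: near_eq_derivable.
by near=> y; rewrite W_kern.
Unshelve. all: by end_near. Qed.

Lemma Gamma_ge0 s : 0 <= Gamma s.
Proof. by rewrite Kint_GammaE Kint_ge0. Qed.

Lemma Wcst_ge0 a b c : 0 <= Wcst a b c.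
Proof. by rewrite /Wcst !divr_ge0 ?mulr_ge0 ?Gamma_ge0. Qed.

Lemma W_ge0 a b c x : 0 <= W a b c x.
Proof.
rewrite W_kern; apply: mulr_ge0; last exact: Kint_ge0.
apply: mulr_ge0; last exact: powR_ge0.
by apply: mulr_ge0; [exact: Wcst_ge0|exact: expR_ge0].
Qed.

End Weight.

(** * The moments of the weights *)

(** This is the value of the moments as Tonelli's theorem gives it; it equals
    [(a+1)_k (b+1)_k / (c+b+1)_k].  Locked for the same reason as [Kint]. *)
HB.lock Definition Wmoment {R : realType} (a b c : R) (k : nat) : R :=
  Wcst a b c * Gamma (a + 1 + k%:R) * Kint (c - 1) (- (c + b + 1 + k%:R)) 0.

Section Moments.
Set Implicit Arguments.
Unset Strict Implicit.
Local Open Scope classical_set_scope.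
Context {R : realType}.
Local Notation mu := (@lebesgue_measure R).
Implicit Types a b c s x t : R.

Lemma tonelli_half_line (H : R -> R -> R) :
  measurable_fun setT (fun z : R * R => H z.1 z.2) ->
  (forall x t, 0 <= H x t) ->
  (\int[mu]_(x in `]0%R, +oo[) \int[mu]_(t in `]0%R, +oo[) (H x t)%:E =
   \int[mu]_(t in `]0%R, +oo[) \int[mu]_(x in `]0%R, +oo[) (H x t)%:E)%E.
Proof.
move=> mH H0; pose D : set R := `]0, +oo[.
pose f (z : R * R) := (H z.1 z.2 * \1_D z.1 * \1_D z.2)%:E.
have mD : measurable D by exact: measurable_itv.
have mf : measurable_fun setT f.
  apply/measurable_EFinP; apply: measurable_funM; first apply: measurable_funM => //.
    by apply: measurableT_comp; [exact: measurable_indic|exact: measurable_fst].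
  by apply: measurableT_comp; [exact: measurable_indic|exact: measurable_snd].
have f0 z : (0 <= f z)%E by rewrite lee_fin !mulr_ge0.
have := @fubini_tonelli _ _ _ _ R mu mu f mf f0.
pose g x := (\int[mu]_(t in D) (H x t)%:E)%E.
pose h t := (\int[mu]_(x in D) (H x t)%:E)%E.
have E1 : (fun x => \int[mu]_t f (x, t))%E = g \_ D.
  apply/funext => x; rewrite patchE; case: ifPn => xD; last first.
    apply: integral0_eq => t _.
    by rewrite /f /= indicE (negbTE xD) mulr0 mul0r.
  rewrite /g [RHS]integral_mkcond; apply: eq_integral => t _.
  rewrite /f /= patchE !indicE xD mulr1; case: ifPn => _; first by rewrite mulr1.
  by rewrite mulr0.
have E2 : (fun t => \int[mu]_x f (x, t))%E = h \_ D.
  apply/funext => t; rewrite patchE; case: ifPn => tD; last first.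
    apply: integral0_eq => x _.
    by rewrite /f /= [\1_D t]indicE (negbTE tD) mulr0.
  rewrite /h [RHS]integral_mkcond; apply: eq_integral => x _.
  rewrite /f /= patchE !indicE tD mulr1; case: ifPn => _; first by rewrite mulr1.
  by rewrite mulr0.
rewrite E1 E2 => e.
by rewrite [LHS]integral_mkcond [RHS]integral_mkcond; exact: e.
Qed.

Lemma WmomentE a b c (k : nat) : Wmoment a b c k =
  Wcst a b c * Gamma (a + 1 + k%:R) * Kint (c - 1) (- (c + b + 1 + k%:R)) 0.
Proof. by rewrite Wmoment.unlock. Qed.

Lemma natr_gt0D a (k : nat) : 0 < a -> 0 < a + k%:R.
Proof. by move=> a0; rewrite ltr_wpDr. Qed.

(** Integrating first in [x] turns [x^(a+k) e^(-(t+1)x)] into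
    [Gamma(a+k+1) (t+1)^-(a+k+1)]; what is left is a kernel with [x = 0]. *)
Lemma W_moment a b c (k : nat) : -1 < a -> -1 < b -> 0 < c ->
  moment k (W a b c) = (Wmoment a b c k)%:E.
Proof.
move=> a1 b1 c0; pose s := a + 1 + k%:R.
have s0 : 0 < s by apply: natr_gt0D; lra.
have bk0 : 0 < b + 1 + k%:R by apply: natr_gt0D; lra.
pose H x t : R := (Wcst a b c * (x `^ (a + k%:R) * expR (- x))) * kern (c - 1) (a - b - c) x t.
have H0 x t : 0 <= H x t.
  apply: mulr_ge0; last exact: kern_ge0.
  by apply: mulr_ge0; [exact: Wcst_ge0|rewrite mulr_ge0 ?powR_ge0 ?expR_ge0].
have m1 r : measurable_fun setT (fun z : R * R => z.1 `^ r).
  exact: (measurableT_comp (measurable_powR r) measurable_fst).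
have m2 : measurable_fun setT (fun z : R * R => expR (- z.1)).
  apply: (measurableT_comp (@measurable_expR R)).
  exact: (measurableT_comp (@oppr_measurable R setT) measurable_fst).
have m3 r : measurable_fun setT (fun z : R * R => z.2 `^ r).
  exact: (measurableT_comp (measurable_powR r) measurable_snd).
have m4 r : measurable_fun setT (fun z : R * R => (z.2 + 1) `^ r).
  apply: (measurableT_comp (measurable_powR r)).
  by apply: measurable_funD => //; exact: measurable_snd.
have m5 : measurable_fun setT (fun z : R * R => expR (- (z.2 * z.1))).
  apply: (measurableT_comp (@measurable_expR R)).
  apply: (measurableT_comp (@oppr_measurable R setT)).
  by apply: measurable_funM; [exact: measurable_snd|exact: measurable_fst].
have mH : measurable_fun setT (fun z : R * R => H z.1 z.2).
  rewrite /H /kern; apply: measurable_funM; apply: measurable_funM => //.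
    exact: measurable_funM.
  exact: measurable_funM.
rewrite /moment WmomentE.
transitivity (\int[mu]_(x in `]0%R, +oo[) \int[mu]_(t in `]0%R, +oo[) (H x t)%:E)%E.
  apply: eq_integral => x; rewrite inE/= in_itv/= andbT => x0.
  rewrite W_kern /H.
  under [RHS]eq_integral do rewrite EFinM.
  rewrite integralZl//; last by apply: kern_integrable; [lra|left].
  rewrite Kint_EFin; [|lra|by left].
  rewrite -EFinM; congr EFin; rewrite -powR_mulrn ?ltW// powRD; last first.
    by rewrite (gt_eqF x0) implybT.
  ring.
rewrite tonelli_half_line//.
transitivity (\int[mu]_(t in `]0%R, +oo[)
   ((Wcst a b c * Gamma s)%:E * (kern (c - 1) (- (c + b + 1 + k%:R)) 0 t)%:E))%E; last first.
  rewrite integralZl//; last by apply: kern_integrable; [lra|right; split => //; lra].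
  rewrite Kint_EFin; [|lra|right; split => //; lra].
  by rewrite -EFinM.
apply: eq_integral => t; rewrite inE/= in_itv/= andbT => t0.
have t1 : 0 < t + 1 by lra.
rewrite /H.
transitivity (\int[mu]_(x in `]0%R, +oo[)
   ((Wcst a b c * (t `^ (c - 1) * (t + 1) `^ (a - b - c)))%:E *
    (kern (s - 1) 0 (t + 1) x)%:E))%E.
  apply: eq_integral => x _; rewrite -EFinM; congr EFin.
  rewrite /kern powRr0 mulr1 /s (_ : a + 1 + k%:R - 1 = a + k%:R); last by ring.
  have -> : - (x * (t + 1)) = - x + - (t * x) by ring.
  rewrite expRD; ring.
rewrite integralZl//; last by apply: kern_integrable; [lra|left].
rewrite Kint_EFin; [|lra|by left].
rewrite -!EFinM; congr EFin; rewrite Kint_scaling// /kern mulr0 oppr0 expR0 mulr1.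
have -> : - (c + b + 1 + k%:R) = (a - b - c) + - s by rewrite /s; ring.
rewrite (@powRD _ _ (a - b - c) (- s)); last by rewrite (gt_eqF t1) implybT.
ring.
Qed.

(** The factor [a + 1 + k] is the recurrence of Gamma; the factor
    [(b + 1 + k) / (c + b + 1 + k)] is that of the Beta integral. *)
Lemma Wmoment_rec_k a b c (k : nat) : -1 < a -> -1 < b -> 0 < c ->
  (c + b + 1 + k%:R) * Wmoment a b c k.+1 =
  (a + 1 + k%:R) * (b + 1 + k%:R) * Wmoment a b c k.
Proof.
move=> a1 b1 c0.
have s0 : 0 < a + 1 + k%:R by apply: natr_gt0D; lra.
have bk0 : 0 < b + 1 + k%:R by apply: natr_gt0D; lra.
rewrite !WmomentE -natr1 !addrA (Gamma_rec s0).
set m := c + b + 1 + k%:R; set K1 := Kint _ (- m) 0; set K2 := Kint _ (- (m + 1)) 0.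
suff e : m * K2 = (b + 1 + k%:R) * K1.
  have -> : forall g w, m * (w * ((a + 1 + k%:R) * g) * K2) =
    w * (a + 1 + k%:R) * g * (m * K2).
    by move=> *; ring.
  rewrite e; move: (Gamma _) (Wcst _ _ _) => *; ring.
pose K3 := Kint c (- (m + 1)) 0.
have ip : c * K1 + - m * K3 = 0 * Kint c (- m) 0.
  have -> : K3 = Kint c (- m - 1) 0 by rewrite /K3; congr Kint; ring.
  by apply: Kint_by_parts => //; right; split => //; rewrite /m; lra.
have e1 : K1 = K2 + K3.
  have -> : K3 = Kint (c - 1 + 1) (- (m + 1)) 0 by rewrite subrK.
  rewrite /K1 /K2 -Kint_split; [|lra|right; split => //; rewrite /m; lra].
  by have -> : - (m + 1) + 1 = - m by ring.
move: ip; rewrite mul0r e1 => ip; rewrite /m in ip *.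
clear e1; move: K2 K3 ip => k2 k3 ip; lra.
Qed.

Lemma Wmoment_rec_c a b c (k : nat) : -1 < b -> 0 < c ->
  (c + b + 1 + k%:R) * Wmoment a b (c + 1) k = (c + b + 1) * Wmoment a b c k.
Proof.
move=> b1 c0.
have bk0 : 0 < b + 1 + k%:R by apply: natr_gt0D; lra.
rewrite !WmomentE Wcst_rec_c// addrK.
have -> : - (c + 1 + b + 1 + k%:R) = - (c + b + 1 + k%:R) - 1 by ring.
set m := c + b + 1 + k%:R; set K1 := Kint _ (- m) 0; set K2 := Kint _ (- m - 1) 0.
have ip : c * K1 + - m * K2 = 0 * Kint c (- m) 0.
  by apply: Kint_by_parts => //; right; split => //; rewrite /m; lra.
have e : m * K2 = c * K1 by move: ip; rewrite mul0r mulNr => /eqP; rewrite subr_eq0 => /eqP.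
have -> : forall g w, m * ((c + b + 1) / c * w * g * K2) = (c + b + 1) / c * w * g * (m * K2).
  by move=> *; ring.
rewrite e; move: (Gamma _) (Wcst _ _ _) => *; field.
by rewrite gt_eqF.
Qed.

Lemma Wmoment_shift a b c (k : nat) : -1 < a -> -1 < b -> 0 < c ->
  Wmoment (a + 1) (b + 1) c k = (c + b + 1) / ((a + 1) * (b + 1)) * Wmoment a b c k.+1.
Proof.
move=> a1 b1 c0; rewrite !WmomentE Wcst_rec_ab// -natr1.
have -> : a + 1 + 1 + k%:R = a + 1 + (k%:R + 1) by ring.
have -> : c + (b + 1) + 1 + k%:R = c + b + 1 + (k%:R + 1) by ring.
by rewrite !mulrA.
Qed.

Lemma W_integrable a b c (k : nat) : -1 < a -> -1 < b -> 0 < c ->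
  mu.-integrable `]0, +oo[ (fun x => (x ^+ k * W a b c x)%:E).
Proof.
move=> a1 b1 c0; apply/integrableP; split.
  apply/measurable_EFinP; apply: continuous_gt0_measurable => //.
  move=> x x0; apply: continuousM; last exact: W_continuous.
  exact: exprn_continuous.
suff -> : (\int[mu]_(x in `]0%R, +oo[) `|(x ^+ k * W a b c x)%:E| =
    moment k (W a b c))%E by rewrite W_moment// ltry.
apply: eq_integral => x; rewrite inE/= in_itv/= andbT => x0.
by rewrite ger0_norm//; apply: mulr_ge0; [rewrite exprn_ge0// ltW|exact: W_ge0].
Qed.

End Moments.

(** * Uniqueness from a triangular family *)
Section Triangular.
Set Implicit Arguments.
Unset Strict Implicit.

(** [x] gives the coordinates that define the filtration (an element lies in
    step [n] when its coordinates from [n] on vanish) and [L] the moment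
    functionals.  The existence of the triangular family [Q] is what makes the
    moments determine an element: by induction the top coordinate of [Q n] cannot
    vanish, hence a multiple of [Q n] can be subtracted to go down one step, and
    the [n]-th moment shows that this multiple was zero.  It is stated for an
    abstract space because it serves polynomials (type II) and pairs of
    polynomials (type I). *)
Lemma triangular_unique (F : fieldType) (V : lmodType F) (x L : nat -> V -> F)
    (Q : nat -> V) :
  (forall v, (forall i, x i v = 0) -> v = 0) ->
  (forall i t u v, x i (u - t *: v) = x i u - t * x i v) ->
  (forall k t u v, L k (u - t *: v) = L k u - t * L k v) ->
  (forall n i, (n < i)%N -> x i (Q n) = 0) ->
  (forall n k, (k < n)%N -> L k (Q n) = 0) ->
  (forall n, L n (Q n) != 0) ->
  forall n v, (forall i, (n <= i)%N -> x i v = 0) ->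
    (forall k, (k < n)%N -> L k v = 0) -> v = 0.
Proof.
move=> x_inj xB LB xQ LQ LQn; elim=> [|n IH] v xv Lv.
  by apply: x_inj => i; exact: xv.
(* Otherwise Q n would lie in step n with its first n moments zero. *)
have xQn : x n (Q n) != 0.
  apply/eqP => xQn0; have Q0 : Q n = 0.
    apply: IH => [i|k]; last exact: LQ.
    by rewrite leq_eqVlt => /orP[/eqP <-//|]; exact: xQ.
  have := LQn n; rewrite Q0 -[X in L n X](subrr 0) -[X in _ - X]scale1r LB.
  by rewrite mul1r subrr eqxx.
pose t := x n v / x n (Q n).
have vE : v - t *: Q n = 0.
  apply: IH => [i|k kn]; last by rewrite LB Lv 1?ltnW// LQ// mulr0 subr0.
  rewrite xB leq_eqVlt => /orP[/eqP <-|ni]; last by rewrite xv// xQ// mulr0 subr0.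
  by rewrite divfK// subrr.
have /eqP := LB n t v (Q n).
rewrite vE Lv// -[X in L n X](subrr 0) -[X in _ - X]scale1r LB mul1r subrr.
rewrite sub0r eq_sym oppr_eq0 mulf_eq0 (negbTE (LQn n)) orbF => /eqP t0.
by move: vE; rewrite t0 scale0r subr0.
Qed.

End Triangular.

(** * Linear functionals given by moment sequences *)
Section MomentFunctional.
Set Implicit Arguments.
Unset Strict Implicit.
Context {F : fieldType}.
Implicit Types (m : nat -> F) (p q : {poly F}).

Definition momf m p : F := \sum_(i < size p) p`_i * m i.

Lemma momf_widen n m p : (size p <= n)%N -> momf m p = \sum_(i < n) p`_i * m i.
Proof.
move=> pn; rewrite /momf (big_ord_widen _ (fun i => p`_i * m i) pn) big_mkcond /=.
apply: eq_bigr => i _; case: ltnP => // pi.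
by rewrite nth_default// mul0r.
Qed.

Lemma momfD m p q : momf m (p + q) = momf m p + momf m q.
Proof.
pose n := maxn (size p) (size q).
rewrite !(@momf_widen n) ?leq_maxl ?leq_maxr ?size_polyD// -big_split /=.
by apply: eq_bigr => i _; rewrite coefD mulrDl.
Qed.

Lemma momfZ m t p : momf m (t *: p) = t * momf m p.
Proof.
rewrite (@momf_widen (size p)) ?size_scale_leq// mulr_sumr.
by apply: eq_bigr => i _; rewrite coefZ mulrA.
Qed.

Lemma momfB m p q : momf m (p - q) = momf m p - momf m q.
Proof. by rewrite momfD -scaleN1r momfZ mulN1r. Qed.

Lemma momf_mulX m p : momf m ('X * p) = momf (m \o succn) p.
Proof.
rewrite mulrC (@momf_widen (size p).+1); last first.
  by rewrite (leq_trans (size_polyMleq _ _))// size_polyX addn2.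
rewrite big_ord_recl coefMX eqxx mul0r add0r /momf.
by apply: eq_bigr => i _; rewrite coefMX.
Qed.

(** The sequence [i m_(i-1)] is that of the moments of minus the derivative of a
    weight with moments [m]. *)
Lemma momf_deriv m p : momf m p^`() = momf (fun i => i%:R * m i.-1) p.
Proof.
have [->|p0] := eqVneq p 0; first by rewrite deriv0 /momf size_poly0 !big_ord0.
rewrite (momf_widen _ (ltnW (lt_size_deriv p0))).
rewrite (@momf_widen (size p).+1 _ p)// big_ord_recl !mul0r mulr0 add0r.
by apply: eq_bigr => i _; rewrite coef_deriv /= mulrA mulr_natr.
Qed.

Lemma momf_comb s t m1 m2 p :
  momf (fun i => s * m1 i + t * m2 i) p = s * momf m1 p + t * momf m2 p.
Proof.
rewrite /momf !mulr_sumr -big_split /=.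
by apply: eq_bigr => i _; ring.
Qed.

Lemma eq_momf m1 m2 : m1 =1 m2 -> momf m1 =1 momf m2.
Proof. by move=> e p; apply: eq_bigr => i _; rewrite e. Qed.

End MomentFunctional.

(** * Pearson systems on the step-line *)

(** [m1, m2] are the moment sequences of weights [w1, w2], and [n0, n1] those of
    weights [v0, v1] such that
    [v0 = x (e1 w1 + e2 w2)],              [- v0' = f1 w1 + f2 w2],
    [v1 = x ((g1 x + g0) w1 + g2 w2)],     [- v1' = (h1 x + h0) w1 + h2 w2].
    At [k = 0] the predecessor in [k.-1] is harmless, its term being multiplied
    by 0. *)
Record pearson_moments (F : fieldType) (m1 m2 n0 n1 : nat -> F)
    (e1 e2 f1 f2 g1 g0 g2 h1 h0 h2 : F) : Prop := PearsonMoments {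
  pm_e : forall k, n0 k = e1 * m1 k.+1 + e2 * m2 k.+1;
  pm_f : forall k, k%:R * n0 k.-1 = f1 * m1 k + f2 * m2 k;
  pm_g : forall k, n1 k = g1 * m1 k.+2 + g0 * m1 k.+1 + g2 * m2 k.+1;
  pm_h : forall k, k%:R * n1 k.-1 = h1 * m1 k.+1 + h0 * m1 k + h2 * m2 k }.

Section StepLine.
Set Implicit Arguments.
Unset Strict Implicit.
Context {F : fieldType}.
Variables (m1 m2 n0 n1 : nat -> F) (e1 e2 f1 f2 g1 g0 g2 h1 h0 h2 : F).
Hypothesis pm : pearson_moments m1 m2 n0 n1 e1 e2 f1 f2 g1 g0 g2 h1 h0 h2.
Implicit Types p : {poly F}.

Lemma momf_e p : momf n0 p = e1 * momf m1 ('X * p) + e2 * momf m2 ('X * p).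
Proof. by rewrite !momf_mulX -momf_comb; apply: eq_momf; exact: pm_e pm. Qed.

Lemma momf_f p : momf n0 p^`() = f1 * momf m1 p + f2 * momf m2 p.
Proof. by rewrite momf_deriv -momf_comb; apply: eq_momf; exact: pm_f pm. Qed.

Lemma momf_g p :
  momf n1 p = g1 * momf m1 ('X * ('X * p)) + g0 * momf m1 ('X * p) + g2 * momf m2 ('X * p).
Proof.
rewrite !momf_mulX -momf_comb -[X in X + _]mul1r -momf_comb; apply: eq_momf => k.
by rewrite mul1r; exact: pm_g pm k.
Qed.

Lemma momf_h p : momf n1 p^`() = h1 * momf m1 ('X * p) + h0 * momf m1 p + h2 * momf m2 p.
Proof.
rewrite momf_deriv !momf_mulX -momf_comb -[X in X + _]mul1r -momf_comb; apply: eq_momf => k.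
by rewrite mul1r; exact: pm_h pm k.
Qed.

Lemma Xn_deriv k p : 'X^k * p^`() = ('X^k * p)^`() - k%:R *: ('X^(k.-1) * p).
Proof. by rewrite derivM derivXn -scaler_nat scalerAl addrAC subrr add0r. Qed.

Lemma Xk_pred k p : k%:R *: ('X * ('X^(k.-1) * p)) = k%:R *: ('X^k * p).
Proof. by case: k => [|k]; rewrite ?scale0r// mulrA -exprS. Qed.

Lemma momf_e_pred k p :
  k%:R * momf n0 ('X^(k.-1) * p) = k%:R * (e1 * momf m1 ('X^k * p) + e2 * momf m2 ('X^k * p)).
Proof.
by rewrite momf_e mulrDr !(mulrCA k%:R) -!momfZ Xk_pred !momfZ mulrDr !(mulrCA k%:R).
Qed.

Lemma momf_g_pred k p :
  k%:R * momf n1 ('X^(k.-1) * p) =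
  k%:R * (g1 * momf m1 ('X * ('X^k * p)) + g0 * momf m1 ('X^k * p) + g2 * momf m2 ('X^k * p)).
Proof.
rewrite momf_g !mulrDr !(mulrCA k%:R) -!momfZ (scalerAr _ 'X) Xk_pred -scalerAr.
by rewrite !momfZ.
Qed.

Definition orth_step (m n : nat -> F) (P : nat -> {poly F}) := forall k j,
  ((2 * k + 1 <= j)%N -> momf m ('X^k * P j) = 0) /\
  ((2 * k + 2 <= j)%N -> momf n ('X^k * P j) = 0).

(** Leibniz' rule writes [x^k P_(n+1)'] as a derivative minus a multiple of
    [x^(k-1) P_(n+1)]; the Pearson system turns both terms into moments of
    [P_(n+1)] that vanish.  The functionals [L] take the two weights alternately,
    which is the order of the step-line. *)
Lemma typeII_derivative (P P' : nat -> {poly F}) :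
  (forall n, size (P n) = n.+1) -> (forall n, P n \is monic) ->
  (forall n, size (P' n) = n.+1) -> (forall n, P' n \is monic) ->
  orth_step m1 m2 P -> orth_step n0 n1 P' ->
  (forall k, momf n0 ('X^k * P' (2 * k)%N) != 0) ->
  (forall k, momf n1 ('X^k * P' (2 * k + 1)%N) != 0) ->
  forall n, (P n.+1)^`() = n.+1%:R *: P' n.
Proof.
move=> sP mP sP' mP' oP oP' nz0 nz1 n.
pose L (k : nat) p := if odd k then momf n1 ('X^(k./2) * p) else momf n0 ('X^(k./2) * p).
have half k : k = (odd k + 2 * k./2)%N by rewrite mul2n odd_double_half.
apply/eqP; rewrite -subr_eq0; apply/eqP.
apply: (@triangular_unique F {poly F} (fun i p => p`_i) L P' _ _ _ _ _ _ n).
- by move=> p p0; apply/polyP => i; rewrite p0 coef0.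
- by move=> i t u v; rewrite coefB coefZ.
- by move=> k t u v; rewrite /L; case: ifP => _; rewrite mulrBr -scalerAr momfB momfZ.
- by move=> j i ji; rewrite nth_default// sP'.
- move=> j k kj; rewrite /L; have hk := half k; case: ifP => ok; rewrite ok in hk.
    by apply: (oP' _ _).2; lia.
  by apply: (oP' _ _).1; lia.
- move=> j; rewrite /L; have hk := half j; case: ifP => ok; rewrite ok in hk.
    by have := nz1 j./2; rewrite (_ : (_ + _)%N = j); last lia.
  by have := nz0 j./2; rewrite (_ : (_ * _)%N = j); last lia.
- move=> i ni; rewrite coefB coefZ coef_deriv.
  move: ni; rewrite leq_eqVlt => /orP[/eqP <-|ni].
    have /monicP := mP n.+1; have /monicP := mP' n; rewrite !lead_coefE sP sP' /= => -> ->.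
    by rewrite mulr1 subrr.
  by rewrite !nth_default ?sP ?sP'// mul0rn mulr0 subrr.
- move=> k kn; rewrite /L; have hk := half k; case: ifP => ok; rewrite ok in hk.
    rewrite mulrBr momfB -scalerAr momfZ (oP' _ _).2 ?mulr0 ?subr0; last lia.
    rewrite Xn_deriv momfB momfZ momf_h momf_g_pred mulrA -exprS.
    rewrite (oP _ _).1 ?(oP k./2 _).1 ?(oP _ _).2; try lia.
    by rewrite !mulr0 !addr0 mulr0 subr0.
  rewrite mulrBr momfB -scalerAr momfZ (oP' _ _).1 ?mulr0 ?subr0; last lia.
  rewrite Xn_deriv momfB momfZ momf_f momf_e_pred.
  rewrite (oP _ _).1 ?(oP _ _).2; try lia.
  by rewrite !mulr0 !addr0 mulr0 subr0.
Qed.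

Definition typeI_data (m n : nat -> F) (A B : nat -> {poly F}) := forall j,
  [/\ (size (A j) <= uphalf j)%N, (size (B j) <= j./2)%N,
   forall k, (k + 2 <= j)%N -> momf m ('X^k * A j) + momf n ('X^k * B j) = 0 &
   forall k, (k + 1)%N = j -> momf m ('X^k * A j) + momf n ('X^k * B j) = 1].

(** The coefficients of [w1] and of [w2] in [- (A v0 + B v1)']. *)
Definition derivA A B := f1 *: A - e1 *: ('X * A^`())
  + (h1 *: ('X * B) + h0 *: B) - (g1 *: ('X * ('X * B^`())) + g0 *: ('X * B^`())).

Definition derivB A B := f2 *: A - e2 *: ('X * A^`()) + h2 *: B - g2 *: ('X * B^`()).

(** Integration by parts in [x] for the function [A v0 + B v1]. *)
Lemma momf_derivAB k A B : momf m1 ('X^k * derivA A B) + momf m2 ('X^k * derivB A B) =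
  k%:R * (momf n0 ('X^(k.-1) * A) + momf n1 ('X^(k.-1) * B)).
Proof.
have a : k%:R * momf n0 ('X^(k.-1) * A) = momf n0 ('X^k * A)^`() - momf n0 ('X^k * A^`()).
  by rewrite Xn_deriv momfB momfZ opprB addrC subrK.
have b : k%:R * momf n1 ('X^(k.-1) * B) = momf n1 ('X^k * B)^`() - momf n1 ('X^k * B^`()).
  by rewrite Xn_deriv momfB momfZ opprB addrC subrK.
have -> : 'X^k * derivA A B = f1 *: ('X^k * A) - e1 *: ('X * ('X^k * A^`()))
    + (h1 *: ('X * ('X^k * B)) + h0 *: ('X^k * B))
    - (g1 *: ('X * ('X * ('X^k * B^`()))) + g0 *: ('X * ('X^k * B^`()))).
  by rewrite /derivA -!mul_polyC; ring.
have -> : 'X^k * derivB A B = f2 *: ('X^k * A) - e2 *: ('X * ('X^k * A^`()))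
    + h2 *: ('X^k * B) - g2 *: ('X * ('X^k * B^`())).
  by rewrite /derivB -!mul_polyC; ring.
rewrite [RHS]mulrDr a b momf_f momf_h momf_e momf_g !(momfB, momfD, momfZ); ring.
Qed.

(** The coefficients of the pair [(A, B)] are interleaved, so that the [n]-th
    step of the filtration is the pair of degree bounds for the index of length
    [n]. *)
Lemma typeI_derivative (A B A' B' : nat -> {poly F}) :
  typeI_data m1 m2 A B -> typeI_data n0 n1 A' B' ->
  forall n, derivA (A' n) (B' n) = n%:R *: A n.+1 /\ derivB (A' n) (B' n) = n%:R *: B n.+1.
Proof.
move=> hQ hQ' n.
pose V : lmodType F := ({poly F} * {poly F})%type.
pose x (i : nat) (v : V) := if odd i then v.2`_(i./2) else v.1`_(i./2).
pose L (k : nat) (v : V) := momf m1 ('X^k * v.1) + momf m2 ('X^k * v.2).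
have half k : k = (odd k + 2 * k./2)%N by rewrite mul2n odd_double_half.
have uph k : uphalf k = (odd k + k./2)%N by rewrite uphalf_half.
have LB k t u v : L k (u - t *: v) = L k u - t * L k v.
  by rewrite /L /= !mulrBr -!scalerAr !momfB !momfZ; ring.
have xsize j (v : V) i : (size v.1 <= uphalf j)%N -> (size v.2 <= j./2)%N ->
    (j <= i)%N -> x i v = 0.
  rewrite /x uph => s1 s2 ji; have hi := half i; have hj := half j.
  case: ifP => oi; rewrite oi in hi; apply: nth_default.
    exact: leq_trans s2 (half_leq ji).
  by apply: (leq_trans s1); move: hj; case: (odd j) => /= hj; lia.
suff : ((derivA (A' n) (B' n), derivB (A' n) (B' n)) : V) - n%:R *: ((A n.+1, B n.+1) : V) = 0.
  by case=> /eqP + /eqP; rewrite !subr_eq0 => /eqP -> /eqP ->.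
have [sA sB mA1 mB1] := hQ n.+1; have [sA' sB' mA' mB'] := hQ' n.
have szD (p q : {poly F}) r : (size p <= r)%N -> (size q <= r)%N -> (size (p + q)%R <= r)%N.
  by move=> pr qr; rewrite (leq_trans (size_polyD _ _))// geq_max pr.
have szB (p q : {poly F}) r : (size p <= r)%N -> (size q <= r)%N -> (size (p - q)%R <= r)%N.
  by move=> pr qr; apply: szD; rewrite ?size_polyN.
have szZ t (p : {poly F}) r : (size p <= r)%N -> (size (t *: p)%R <= r)%N.
  exact/leq_trans/size_scale_leq.
have szX (p : {poly F}) r : (size p <= r)%N -> (size ('X * p)%R <= r.+1)%N.
  move=> pr; rewrite mulrC (leq_trans (size_polyMleq _ _))// size_polyX addn2.
  by rewrite ltnS.
have szXd (p : {poly F}) r : (size p <= r)%N -> (size ('X * p^`())%R <= r)%N.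
  have [->|p0] := eqVneq p 0; first by rewrite deriv0 mulr0 size_poly0.
  apply: leq_trans; rewrite mulrC (leq_trans (size_polyMleq _ _))// size_polyX.
  by rewrite addn2 lt_size_deriv.
have un : (uphalf n <= n./2.+1)%N by rewrite uph; case: (odd n).
have nu : (n./2 <= uphalf n)%N by rewrite uph leq_addl.
apply: (@triangular_unique F V x L (fun j => (A j.+1, B j.+1)) _ _ _ _ _ _ n.+1).
- move=> [p q] pq0; congr pair; apply/polyP => i; rewrite coef0.
    by have := pq0 i.*2; rewrite /x odd_double half_double.
  by have := pq0 i.*2.+1; rewrite /x /= odd_double /= uphalf_double.
- by move=> i t u v; rewrite /x; case: ifP => _; rewrite /= coefB coefZ.
- exact: LB.
- move=> j i ji; have [] := hQ j.+1; move=> s1 s2 _ _; exact: (xsize j.+1).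
- by move=> j k kj; have [_ _ + _] := hQ j.+1; apply; lia.
- move=> j; have [_ _ _ h] := hQ j.+1.
  by rewrite /L /= h ?oner_neq0// addn1.
- move=> i; apply: xsize.
    rewrite /derivA; apply: (szB); last exact: szZ.
    apply: (szB); last (apply: (szD); apply: (szZ)).
      apply: (szD); [apply: (szB); apply: (szZ)|apply: (szD); apply: (szZ)].
      - exact: leq_trans sA' un.
      - exact: leq_trans (szXd _ _ sA') un.
      - exact: szX.
      - exact: leqW.
    - exact/szX/szXd.
    - exact/leqW/szXd.
  rewrite /derivB; apply: (szB); last exact: szZ.
  apply: (szB); last apply: (szZ).
    apply: (szD); last apply: (szZ).
      apply: (szB); apply: (szZ).
        exact: sA'.
      exact: szXd.
    exact: leq_trans nu.
  exact: leq_trans (szXd _ _ sB') nu.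
- move=> k kn; rewrite LB {1}/L /= momf_derivAB.
  have -> : L k (A n.+1, B n.+1) = (k == n)%:R.
    have [kn'|kn'] := eqVneq k n; first by rewrite /L /= mB1// kn' addn1.
    by rewrite /L /= mA1//; lia.
  case: k kn => [_|k kn].
    by rewrite mul0r; case: (n) => [|n']; rewrite ?mul0r ?mulr0 subrr.
  have [kn'|kn'] := eqVneq k.+1 n; first by rewrite mB' ?addn1// kn' subrr.
  by rewrite mA' ?mulr0 ?subrr//; lia.
Qed.

End StepLine.

(** * From moment sequences to weights *)
Section Glue.
Set Implicit Arguments.
Unset Strict Implicit.
Context {R : realType}.
Local Open Scope classical_set_scope.
Local Notation mu := (@lebesgue_measure R).

(** Integrability is part of the definition so that moments may be added. *)
Definition has_moments (w : R -> R) (m : nat -> R) := forall k,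
  mu.-integrable `]0, +oo[ (fun x => (x ^+ k * w x)%:E) /\ moment k w = (m k)%:E.

Lemma has_moments_poly w m (p : {poly R}) : has_moments w m ->
  has_moments (fun x => p.[x] * w x) (fun k => momf m ('X^k * p)).
Proof.
move=> wm; elim/poly_ind: p => [|p c IH] k.
  have -> : (fun x => (x ^+ k * (0.[x] * w x))%:E) = cst 0%E.
    by apply/funext => x; rewrite horner0 mul0r mulr0.
  split; first exact: integrable0.
  rewrite mulr0 /momf size_poly0 big_ord0 /moment.
  by apply: integral0_eq => x _; rewrite horner0 mul0r mulr0.
have [i1 e1] := IH k.+1; have [i2 e2] := wm k.
have E : (fun x => (x ^+ k * ((p * 'X + c%:P).[x] * w x))%:E) =
  (fun x => (x ^+ k.+1 * (p.[x] * w x))%:E + c%:E * (x ^+ k * w x)%:E)%E.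
  by apply/funext => x; rewrite -EFinM -EFinD hornerMXaddC exprS; congr EFin; ring.
have i3 : mu.-integrable `]0, +oo[ (fun x => c%:E * (x ^+ k * w x)%:E)%E.
  by apply: integrableZl => //; exact: measurable_itv.
split; first by rewrite E; exact: integrableD.
rewrite /moment E integralD//=.
rewrite integralZl//.
move: e1 e2; rewrite /moment => -> ->.
rewrite -EFinM -EFinD; congr EFin.
have -> : 'X^k * (p * 'X + c%:P) = 'X^(k.+1) * p + c *: 'X^k.
  by rewrite exprS -mul_polyC; ring.
rewrite momfD momfZ; congr (_ + _ * _).
rewrite /momf size_polyXn (bigD1 ord_max)//= big1 => [|i]; last first.
  by rewrite -val_eqE/= coefXn => /negbTE ->; rewrite mul0r.
by rewrite coefXn eqxx mul1r addr0.
Qed.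

Lemma has_momentsD w1 w2 m1 m2 : has_moments w1 m1 -> has_moments w2 m2 ->
  has_moments (fun x => w1 x + w2 x) (fun k => m1 k + m2 k).
Proof.
move=> h1 h2 k; have [i1 e1] := h1 k; have [i2 e2] := h2 k.
have E : (fun x => (x ^+ k * (w1 x + w2 x))%:E) =
  (fun x => (x ^+ k * w1 x)%:E + (x ^+ k * w2 x)%:E)%E.
  by apply/funext => x; rewrite -EFinD mulrDr.
split; first by rewrite E; exact: integrableD.
rewrite /moment E integralD//=.
by move: e1 e2; rewrite /moment => -> ->.
Qed.

Lemma eq_moment (f g : R -> R) k : (forall x, 0 < x -> f x = g x) ->
  moment k f = moment k g.
Proof.
move=> fg; apply: eq_integral => x; rewrite inE/= in_itv/= andbT => x0.
by rewrite fg.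
Qed.

Variables (w1 w2 v0 v1 : R -> R) (m1 m2 n0 n1 : nat -> R).
Variables (e1 e2 f1 f2 g1 g0 g2 h1 h0 h2 : R).
Hypothesis pm : pearson_moments m1 m2 n0 n1 e1 e2 f1 f2 g1 g0 g2 h1 h0 h2.
Hypotheses (mw1 : has_moments w1 m1) (mw2 : has_moments w2 m2).
Hypotheses (mv0 : has_moments v0 n0) (mv1 : has_moments v1 n1).

Lemma two_orthogonal_orth (u1 u2 : R -> R) q1 q2 (P : nat -> {poly R}) :
  has_moments u1 q1 -> has_moments u2 q2 -> two_orthogonal (u1, u2) P ->
  [/\ orth_step q1 q2 P, (forall k, momf q1 ('X^k * P (2 * k)%N) != 0) &
    (forall k, momf q2 ('X^k * P (2 * k + 1)%N) != 0)].
Proof.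
move=> hu1 hu2 [_ oP].
pose E1 k n := (has_moments_poly (P n) hu1 k).2.
pose E2 k n := (has_moments_poly (P n) hu2 k).2.
split=> [k n|k|k].
- have [r1 _ r2 _] := oP k n.
  split => /[dup] kn; first by move/r1; rewrite E1 => -[].
  by move/r2; rewrite E2 => -[].
- have [_ /(_ erefl) + _ _] := oP k (2 * k)%N.
  by rewrite E1 => h; apply/eqP => h'; apply: h; rewrite h'.
- have [_ _ _ /(_ erefl)] := oP k (2 * k + 1)%N.
  by rewrite E2 => h; apply/eqP => h'; apply: h; rewrite h'.
Qed.

Lemma typeII_derivative_weights P P' : monic_two_orthogonal (w1, w2) P ->
  monic_two_orthogonal (v0, v1) P' ->
  forall n, deriv (P n.+1) = n.+1%:R *: P' n.
Proof.
move=> [ oP mP] [ oP' mP'].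
have [ r _ _] := two_orthogonal_orth mw1 mw2 oP.
have [r' z0 z1] := two_orthogonal_orth mv0 mv1 oP'.
exact: (typeII_derivative pm oP.1 mP oP'.1 mP' r r' z0 z1).
Qed.

Lemma typeI_function_data (u1 u2 : R -> R) q1 q2 (Q : nat -> R -> R) :
  has_moments u1 q1 -> has_moments u2 q2 ->
  (forall n, typeI_function (u1, u2) n (Q n)) ->
  exists A B : nat -> {poly R}, typeI_data q1 q2 A B /\
    forall n x, 0 < x -> Q n x = (A n).[x] * u1 x + (B n).[x] * u2 x.
Proof.
move=> hu1 hu2 hQ.
have /choice[AB hAB] : forall n, exists AB : {poly R} * {poly R},
   [/\ (size AB.1 <= uphalf n)%N, (size AB.2 <= n./2)%N,
        forall x, 0 < x -> Q n x = AB.1.[x] * u1 x + AB.2.[x] * u2 x,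
        forall k : nat, (k + 2 <= n)%N -> moment k (Q n) = 0%E
      & forall k : nat, (k + 1)%N = n -> moment k (Q n) = 1%E].
  by move=> n; have [A [B h]] := hQ n; exists (A, B).
exists (fst \o AB), (snd \o AB); split; last by move=> n; have [] := hAB n.
move=> n; have [sA sB QE Q0 Q1] := hAB n.
pose E k := (has_momentsD (has_moments_poly (AB n).1 hu1)
  (has_moments_poly (AB n).2 hu2) k).2.
split => // k kn.
  by have := Q0 k kn; rewrite (eq_moment k QE) E => -[].
by have := Q1 k kn; rewrite (eq_moment k QE) E => -[].
Qed.

Hypothesis v0E : forall x : R, 0 < x -> v0 x = x * (e1 * w1 x + e2 * w2 x).
Hypothesis v0D : forall x : R, 0 < x -> is_derive x 1 v0 (- (f1 * w1 x + f2 * w2 x)).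
Hypothesis v1E : forall x : R, 0 < x ->
  v1 x = x * ((g1 * x + g0) * w1 x + g2 * w2 x).
Hypothesis v1D : forall x : R, 0 < x ->
  is_derive x 1 v1 (- ((h1 * x + h0) * w1 x + h2 * w2 x)).

Lemma typeI_derivative_weights Q Q' : (forall n, typeI_function (w1, w2) n (Q n)) ->
  (forall n, typeI_function (v0, v1) n (Q' n)) ->
  forall (n : nat) (x : R), 0 < x -> is_derive x 1 (Q' n) (- (n%:R * Q n.+1 x)).
Proof.
move=> /(typeI_function_data mw1 mw2)[A [B [hQ QE]]].
move=> /(typeI_function_data mv0 mv1)[A' [B' [hQ' QE']]] n x x0.
have [eA eB] := typeI_derivative pm hQ hQ' n.
have d := is_deriveD (is_deriveM (is_derive_poly (A' n) x) (v0D x0))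
  (is_deriveM (is_derive_poly (B' n) x) (v1D x0)).
apply: near_eq_is_derive; last first.
  apply: is_derive_eq d _.
  rewrite QE// mulrDr !mulrA -!hornerZ -eA -eB /derivA /derivB !hornerE /GRing.scale/=.
  rewrite (v0E x0) (v1E x0); ring.
near=> y; have y0 : 0 < y by near: y; exact: lt_nbhsr.
by rewrite QE'.
Unshelve. all: by end_near. Qed.

End Glue.

(** * The Pearson systems of the two vectors of weights *)
Section Final.
Set Implicit Arguments.
Unset Strict Implicit.
Context {R : realType}.
Implicit Types a b c : R.

Lemma W_has_moments a b c : -1 < a -> -1 < b -> 0 < c ->
  has_moments (W a b c) (Wmoment a b c).
Proof. by move=> a1 b1 c0 k; split; [exact: W_integrable|exact: W_moment]. Qed.

Lemma Wmoment_shift_pred a b c k : -1 < a -> -1 < b -> 0 < c ->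
  k%:R * Wmoment (a + 1) (b + 1) c k.-1 =
  (c + b + 1) / ((a + 1) * (b + 1)) * (k%:R * Wmoment a b c k).
Proof.
move=> a1 b1 c0; case: k => [|k]; first by rewrite !mul0r mulr0.
by rewrite /= Wmoment_shift// mulrCA.
Qed.

(** The counterpart of [xW_is_derive_S] for moments. *)
Lemma Wmoment_S a b c k : -1 < b -> 0 < c ->
  k%:R * Wmoment a b (c + 1) k = (c + b + 1) * (Wmoment a b c k - Wmoment a b (c + 1) k).
Proof.
move=> b1 c0; have := Wmoment_rec_c a k b1 c0.
move: (Wmoment _ _ _ _) (Wmoment _ _ _ _) => u v; lra.
Qed.

(** The counterpart of [xW_is_derive] for moments. *)
Lemma Wmoment_SS a b c k : -1 < a -> -1 < b -> 0 < c ->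
  k%:R * Wmoment a b c k = (a + 1 - c) * (- Wmoment a b c k) + Wmoment a b c k.+1
   + (a - b - c) * c / (c + b + 1) * Wmoment a b (c + 1) k.
Proof.
move=> a1 b1 c0; have e1 := Wmoment_rec_c a k b1 c0; have e2 := Wmoment_rec_k k a1 b1 c0.
have C0 : c + b + 1 + k%:R != 0.
  by rewrite gt_eqF//; apply: natr_gt0D; lra.
have C1 : c + b + 1 != 0 by rewrite gt_eqF//; lra.
have -> : Wmoment a b (c + 1) k = (c + b + 1) / (c + b + 1 + k%:R) * Wmoment a b c k.
  by apply: (mulfI C0); rewrite e1; move: (Wmoment _ _ _ _) => u; field.
have -> : Wmoment a b c k.+1 =
    (a + 1 + k%:R) * (b + 1 + k%:R) / (c + b + 1 + k%:R) * Wmoment a b c k.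
  by apply: (mulfI C0); rewrite e2; move: (Wmoment _ _ _ _) => u; field.
by move: (Wmoment _ _ _ _) => u; field; rewrite C0 C1.
Qed.

(** The counterpart of [W_contiguous] for moments. *)
Lemma Wmoment_contiguous a b c k : -1 < a -> -1 < b -> 0 < c ->
  (a - b - (c + 1)) * (c + 1) / (c + b + 2) * Wmoment a b (c + 2) k =
  (a - b - 2 * c - 1) * Wmoment a b (c + 1) k - Wmoment a b (c + 1) k.+1
  + (c + b + 1) * Wmoment a b c k.
Proof.
move=> a1 b1 c0; have c1 : 0 < c + 1 by lra.
have := Wmoment_SS k a1 b1 c1; rewrite Wmoment_S//.
have -> : c + 1 + 1 = c + 2 by ring.
have -> : c + 1 + b + 1 = c + b + 2 by ring.
move: (_ / (c + b + 2)) => r.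
move: (Wmoment a b c k) (Wmoment a b (c + 1) k) (Wmoment a b (c + 1) k.+1) => u v w.
move: (Wmoment a b (c + 2) k) => z; lra.
Qed.

Lemma pearson_moments_d0 a b c (K0 := (c + b + 2) / ((a + 1) * (b + 1)))
    (K1 := (c + b + 1) / ((a + 1) * (b + 1))) :
  -1 < a -> -1 < b -> 0 < c ->
  pearson_moments (Wmoment a b c) (Wmoment a b (c + 1))
    (Wmoment (a + 1) (b + 1) (c + 1)) (Wmoment (a + 1) (b + 1) c)
    0 K0 (K0 * (c + b + 1)) (- (K0 * (c + b + 1)))
    0 K1 0 K1 (- (K1 * (a + 1 - c))) (K1 * ((a - b - c) * c / (c + b + 1))).
Proof.
move=> a1 b1 c0; have c1 : 0 < c + 1 by lra.
have E : c + 1 + b + 1 = c + b + 2 by ring.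
split=> k.
- by rewrite Wmoment_shift// E -/K0; clearbody K0; ring.
- rewrite Wmoment_shift_pred// E -/K0 Wmoment_S//.
  by move: (Wmoment _ _ _ _) (Wmoment _ _ _ _) => u v; clearbody K0; ring.
- by rewrite Wmoment_shift// -/K1; clearbody K1; ring.
- rewrite Wmoment_shift_pred// -/K1 Wmoment_SS//.
  move: (Wmoment a b c k) (Wmoment a b c k.+1) (Wmoment a b (c + 1) k) => u v w.
  move: (_ / (c + b + 1)) => r; clearbody K1; ring.
Qed.

(** The raised vector involves [c + 2]; contiguity brings it back to [c] and
    [c + 1], which needs the leading factor [a - b - (c + 1)] to be nonzero:
    hence the hypothesis [a - b < c]. *)
Lemma pearson_moments_d1 a b c (K0 := (c + b + 2) / ((a + 1) * (b + 1)))
    (K1 := (c + b + 3) / ((a + 1) * (b + 1)))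
    (r := ((a - b - (c + 1)) * (c + 1) / (c + b + 2))^-1) :
  -1 < a -> -1 < b -> 0 < c -> a - b < c ->
  pearson_moments (Wmoment a b (c + 1)) (Wmoment a b c)
    (Wmoment (a + 1) (b + 1) (c + 1)) (Wmoment (a + 1) (b + 1) (c + 2))
    K0 0 (- (K0 * (c + b + 1))) (K0 * (c + b + 1))
    (- (K1 * r)) (K1 * r * (a - b - 2 * c - 1)) (K1 * r * (c + b + 1))
    (K1 * (c + b + 2) * r)
    (- (K1 * (c + b + 2) * (r * (a - b - 2 * c - 1) - 1)))
    (- (K1 * (c + b + 2) * r * (c + b + 1))).
Proof.
move=> a1 b1 c0 cab; have c1 : 0 < c + 1 by lra.
have c2 : 0 < c + 2 by lra.
have E1 : c + 1 + b + 1 = c + b + 2 by ring.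
have E2 : c + 2 + b + 1 = c + b + 3 by ring.
have contig k : Wmoment a b (c + 2) k =
    r * ((a - b - 2 * c - 1) * Wmoment a b (c + 1) k - Wmoment a b (c + 1) k.+1
         + (c + b + 1) * Wmoment a b c k).
  rewrite -Wmoment_contiguous// mulrA mulVf ?mul1r//.
  by rewrite !mulf_neq0 ?invr_eq0//; [rewrite lt_eqF//; lra|rewrite gt_eqF//; lra..].
split=> k.
- by rewrite Wmoment_shift// E1 -/K0; clearbody K0; ring.
- rewrite Wmoment_shift_pred// E1 -/K0 Wmoment_S//.
  by move: (Wmoment _ _ _ _) (Wmoment _ _ _ _) => u v; clearbody K0; ring.
- rewrite Wmoment_shift// E2 -/K1 contig.
  clearbody K1 r; ring.
- have -> : c + 2 = c + 1 + 1 by ring.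
  rewrite Wmoment_shift_pred//; last lra.
  rewrite Wmoment_S//.
  have -> : c + 1 + 1 = c + 2 by ring.
  rewrite E1 E2 -/K1 contig.
  clearbody K1 r; ring.
Qed.

End Final.

Theorem theorem2p8 (R : realType) (a b c : R) (d : nat)
    (ha : -1 < a) (hb : -1 < b) (hc : Num.max 0 (a - b) < c)
    (hd : (d = 0)%N \/ (d = 1)%N) :
  (forall P P' : nat -> {poly R},
    monic_two_orthogonal (Wbar d a b c) P ->
    monic_two_orthogonal (Wbar (1 - d) (a + 1) (b + 1) (c + d%:R)) P' ->
    forall n : nat, (P n.+1)^`() = n.+1%:R *: P' n)
  /\
  (forall Q Q' : nat -> R -> R,
    (forall n : nat, typeI_function (Wbar d a b c) n (Q n)) ->
    (forall n : nat,
      typeI_function (Wbar (1 - d) (a + 1) (b + 1) (c + d%:R)) n (Q' n)) ->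
    forall (n : nat) (x : R), 0 < x ->
      is_derive x 1 (Q' n) (- (n%:R * Q n.+1 x))).
Proof.
move: hc; rewrite gt_max => /andP[c0 cab].
have c1 : 0 < c + 1 by lra.
have c2 : 0 < c + 2 by lra.
have a2 : -1 < a + 1 by lra.
have b2 : -1 < b + 1 by lra.
have m0 := W_has_moments ha hb c0; have m1 := W_has_moments ha hb c1.
have n0 := W_has_moments a2 b2 c0; have n1 := W_has_moments a2 b2 c1.
have n2 := W_has_moments a2 b2 c2.
have [-> | ->] : d = 0%N \/ d = 1%N by [].
  have -> : Wbar 0 a b c = (W a b c, W a b (c + 1)) by rewrite /Wbar addr0 subr0.
  have -> : Wbar (1 - 0) (a + 1) (b + 1) (c + 0%:R) =
      (W (a + 1) (b + 1) (c + 1), W (a + 1) (b + 1) c).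
    by rewrite /Wbar subn0 addr0 addrK.
  have sys := pearson_moments_d0 ha hb c0.
  split; first by move=> P P'; exact: (typeII_derivative_weights sys m0 m1 n1 n0).
  apply: (typeI_derivative_weights sys m0 m1 n1 n0) => x x0.
  - rewrite W_shift//; have -> : c + 1 + b + 1 = c + b + 2 by ring.
    by move: (W a b c x) (W a b (c + 1) x) => u v; ring.
  - apply: is_derive_eq (Wshift_is_derive_S ha hb c0 x0) _.
    by move: (W a b c x) (W a b (c + 1) x) => u v; ring.
  - by rewrite W_shift//; move: (W a b c x) (W a b (c + 1) x) => u v; ring.
  - apply: is_derive_eq (Wshift_is_derive ha hb c0 x0) _.
    by move: (W a b c x) (W a b (c + 1) x) => u v; ring.
have -> : Wbar 1 a b c = (W a b (c + 1), W a b c) by rewrite /Wbar addrK.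
have -> : Wbar (1 - 1) (a + 1) (b + 1) (c + 1%:R) =
    (W (a + 1) (b + 1) (c + 1), W (a + 1) (b + 1) (c + 2)).
  by rewrite /Wbar subnn addr0 subr0; have -> : c + 1 + 1 = c + 2 by ring.
have sys := pearson_moments_d1 ha hb c0 cab.
split; first by move=> P P'; exact: (typeII_derivative_weights sys m1 m0 n1 n2).
have contig x : 0 < x -> W a b (c + 2) x =
   ((a - b - (c + 1)) * (c + 1) / (c + b + 2))^-1 *
   ((a - b - 2 * c - 1 - x) * W a b (c + 1) x + (c + b + 1) * W a b c x).
  move=> x0; rewrite -W_contiguous// mulKf//.
  by rewrite !mulf_neq0 ?invr_eq0//; [rewrite lt_eqF//; lra|rewrite gt_eqF//; lra..].
apply: (typeI_derivative_weights sys m1 m0 n1 n2) => x x0.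
- rewrite W_shift//; have -> : c + 1 + b + 1 = c + b + 2 by ring.
  by move: (W a b c x) (W a b (c + 1) x) => u v; ring.
- apply: is_derive_eq (Wshift_is_derive_S ha hb c0 x0) _.
  by move: (W a b c x) (W a b (c + 1) x) => u v; ring.
- rewrite W_shift// contig//; have -> : c + 2 + b + 1 = c + b + 3 by ring.
  move: (((_ - _) * _ / _)^-1) (W a b c x) (W a b (c + 1) x) => r u v; ring.
- have h := Wshift_is_derive_S ha hb c1 x0.
  have e : c + 1 + 1 = c + 2 by ring.
  rewrite e in h.
  apply: is_derive_eq h _; rewrite contig//.
  have -> : c + 1 + b + 2 = c + b + 3 by ring.
  have -> : c + 1 + b + 1 = c + b + 2 by ring.
  move: (((_ - _) * _ / _)^-1) (W a b c x) (W a b (c + 1) x) => r u v; ring.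
Qed.
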